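(* Let $G$ be a finite group, $\omega\in Z^3(G,\mathbb{C}^\times)$ a (normalized) 3-cocycle, and $n\geq 1$. If $L(H,\gamma)$ is a Lagrangian algebra in $\mathcal{Z}(\operatorname{Vec}_G^\omega)$, then: (a) the action of the braid group $\mathcal{B}_n$ on $\operatorname{Hom}_{\mathcal{Z}(\operatorname{Vec}_G^\omega)}(\mathbb{C},L(H,\gamma)^{\otimes n})$ is monomial, i.e. this space carries the structure of a monomial space on which $\mathcal{B}_n$ acts by a monomial representation; (b) the dimension of $\operatorname{Hom}_{\mathcal{Z}(\operatorname{Vec}_G^\omega)}(\mathbb{C},L(H,\gamma)^{\otimes n})$ is equal to the number of regular $G$-orbits under the monomial action of $G$ on $$\big((G\times_H H)^{\times n}\big)_e:=\{((g_1,h_1),\ldots,(g_n,h_n)) : g_1h_1g_1^{-1}\,g_2h_2g_2^{-1}\cdots g_nh_ng_n^{-1}=e\}.$$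
   Context: Monomial spaces and representations. A monomial space is a triple $(V,X,(V_x)_{x\in X})$ with $V$ a finite dimensional complex vector space, $X$ a finite set, and $V_x\subseteq V$ one-dimensional subspaces with $V=\bigoplus_{x\in X}V_x$. A monomial representation of a group $\Gamma$ on it is a linear representation of $\Gamma$ on $V$ such that each group element permutes the $V_x$; then $\Gamma$ acts on $X$. An element $x\in X$ is regular if every element of its stabilizer acts as the identity on $V_x$; regularity depends only on the orbit, and a regular orbit is an orbit of regular elements. The category $\mathcal{Z}(\operatorname{Vec}_G^\omega)$. Let $e$ be the identity of $G$ and ${}^gh=ghg^{-1}$. A normalized 3-cocycle is a map $\omega:G\times G\times G\to\mathbb{C}^\times$ with $\omega(ab,c,d)\,\omega(a,b,cd)=\omega(a,b,c)\,\omega(a,bc,d)\,\omega(b,c,d)$ and $\omega(a,e,b)=1$. Put $$\omega(g,g';h)=\frac{\omega({}^{gg'}h,g,g')\,\omega(g,g',h)}{\omega(g,{}^{g'}h,g')},\qquad \omega(g;f,h)=\frac{\omega({}^gf,g,h)}{\omega(g,f,h)\,\omega({}^gf,{}^gh,g)}.$$ Objects are $G$-graded vector spaces $V=\bigoplus_{g\in G}V_g$ with linear maps $v\mapsto g\triangleright v$ ($g\in G$), the twisted $G$-action, such that $e\triangleright v=v$, $(gh)\triangleright v=\omega(g,h;k)\,(g\triangleright(h\triangleright v))$ for $v\in V_k$, and $g\triangleright V_h\subseteq V_{ghg^{-1}}$. Morphisms are linear maps preserving the grading and commuting with the twisted action. The tensor product is the usual tensor product with $(V\otimes W)_g=\bigoplus_{h}V_h\otimes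 W_{h^{-1}g}$ and $h\triangleright(v\otimes w)=\omega(h;g,l)\,(h\triangleright v)\otimes(h\triangleright w)$ for $v\in V_g,w\in W_l$. The associativity constraint is $a_{V,W,Z}((v\otimes w)\otimes z)=\omega(g,h,k)\,v\otimes(w\otimes z)$ for $v\in V_g,w\in W_h,z\in Z_k$, the unit object is $\mathbb{C}$ (degree $e$, trivial action), and the braiding is $c_{V,W}(v\otimes w)=(g\triangleright w)\otimes v$ for $v\in V_g$. We write $|v|=k$ for $v\in V_k$. Braid group action. $V^{\otimes n}$ is parenthesized from the left: $(\cdots(V\otimes V)\otimes\cdots)\otimes V$. The generator $\sigma_i\in\mathcal{B}_n$ ($1\le i\le n-1$) acts on $V^{\otimes n}$ by $$\sigma_i'=(a^{-1}_{V^{\otimes(i-1)},V,V}\otimes\operatorname{id})\circ\big((\operatorname{id}_{V^{\otimes(i-1)}}\otimes c_{V,V})\otimes\operatorname{id}\big)\circ(a_{V^{\otimes(i-1)},V,V}\otimes\operatorname{id}),$$ where the last $\operatorname{id}$ in each factor is on the remaining $n-i-1$ tensor factors; this defines a homomorphism $\mathcal{B}_n\to\operatorname{Aut}(V^{\otimes n})$, and $\mathcal{B}_n$ acts on $\operatorname{Hom}(\mathbb{C},V^{\otimes n})=((V^{\otimes n})_e)^G$ by post-composition. The Lagrangian algebra $L(H,\gamma)$. Let $H\subseteq G$ be a subgroup and $\gamma:H\times H\to\mathbb{C}^\times$ a map with $\frac{\gamma(ab,c)\gamma(a,b)}{\gamma(a,bc)\gamma(b,c)}=\omega(a,b,c)$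 for all $a,b,c\in H$. Let $\mathbb{C}_\gamma[H]=\bigoplus_{h\in H}\mathbb{C}e_h$ with grading $|e_h|=h$ and $$h_1\triangleright e_{h_2}=\epsilon(h_1,h_2)\,e_{h_1h_2h_1^{-1}},\qquad \epsilon(h_1,h_2)=\frac{\gamma(h_1,h_2)}{\gamma({}^{h_1}h_2,h_1)}.$$ On the space of all maps $G\to\mathbb{C}_\gamma[H]$, a map $a$ is homogeneous of degree $|a|=f\in G$ if $a(x)$ is homogeneous of degree $x^{-1}fx$ for all $x\in G$, and the twisted $G$-action is $(g\triangleright a)(x)=\omega(x^{-1},g;|a|)^{-1}\,a(g^{-1}x)$ for homogeneous $a$. Then $L(H,\gamma)\in\mathcal{Z}(\operatorname{Vec}_G^\omega)$ is the submodule spanned by the homogeneous $a$ satisfying $a(xh)=\omega(h^{-1},x^{-1};|a|)\,h^{-1}\triangleright a(x)$ for all $x\in G,h\in H$. Monomial structure. For $g\in G,f\in H$, $\chi_{g,f}\in L(H,\gamma)$ is the map with $\chi_{g,f}(x)=0$ for $x\notin gH$ and $\chi_{g,f}(gh)=\omega(h^{-1},g^{-1};{}^gf)\,\epsilon(h^{-1},f)\,e_{h^{-1}fh}$ for $h\in H$; it has degree $gfg^{-1}$. $G\times_H H$ is the set of $H$-orbits on $G\times H$ for the action $h\cdot(g,h')=(gh^{-1},hh'h^{-1})$, with left $G$-action by left multiplication on the first component; the line $\mathbb{C}\chi_{g,h}$ depends only on the class of $(g,h)$, and $L(H,\gamma)=\bigoplus_{(g,h)\in G\times_H H}\mathbb{C}\chi_{g,h}$,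 with the twisted $G$-action permuting these lines. The twisted action of $G$ on the degree-$e$ part $(L(H,\gamma)^{\otimes n})_e=\bigoplus\mathbb{C}\,\chi_{g_1,h_1}\otimes\cdots\otimes\chi_{g_n,h_n}$, the sum over $((G\times_H H)^{\times n})_e$, is a genuine monomial representation of $G$, and regularity refers to it. *)

(* Defs.v *)
From HB Require Import structures.
From mathcomp Require Import all_boot all_order all_algebra all_fingroup.
From mathcomp Require Import generic_quotient.
From mathcomp Require Import boolp ring.

Set Implicit Arguments.
Unset Strict Implicit.
Unset Printing Implicit Defensive.

Import GRing.Theory.

Local Open Scope ring_scope.
Local Open Scope quotient_scope.

Section Span.
Variables (F : fieldType) (V : vectType F).
Implicit Types (P : V -> Prop) (U : {vspace V}).

Lemma spanP_ex P : exists U,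
  (forall v, P v -> v \in U) /\
  (forall U', (forall v, P v -> v \in U') -> (U <= U')%VS).
Proof.
pose Q d := `[< exists U, (forall v, P v -> v \in U) /\ \dim U = d >].
have exQ : exists d, Q d.
  by exists (\dim {:V}); apply/asboolP; exists fullv; split=> // v _; exact: memvf.
case: (ex_minnP exQ) => d /asboolP[U [PU dU]] mind.
exists U; split=> // U' PU'.
have PI v : P v -> v \in (U :&: U')%VS by move=> Pv; rewrite memv_cap PU ?PU'.
have /eqP <- : (U :&: U')%VS == U.
  rewrite eqEdim capvSl /= dU; apply: mind; apply/asboolP.
  by exists (U :&: U')%VS.
exact: capvSr.
Qed.

Definition span_of P : {vspace V} := projT1 (cid (spanP_ex P)).

Lemma mem_span_of P v : P v -> v \in span_of P.
Proof. by rewrite /span_of; case: cid => U [] /= + _; apply. Qed.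

Lemma span_ofS P U : (forall v, P v -> v \in U) -> (span_of P <= U)%VS.
Proof. by rewrite /span_of; case: cid => U' [] /= _; apply. Qed.

Definition lin_closed P :=
  P 0 /\ forall (a : F) u v, P u -> P v -> P (a *: u + v).

Lemma span_ofP P v : lin_closed P -> (v \in span_of P) <-> P v.
Proof.
move=> [P0 PL]; split; last exact: mem_span_of.
pose p := fun v : V => `[< P v >].
have PZ (a : F) u : P u -> P (a *: u) by move=> Pu; rewrite -[_ *: _]addr0; apply: PL.
have PD u w : P u -> P w -> P (u + w).
  by move=> Pu Pw; rewrite -[u]scale1r; apply: PL.
have [U PU] : exists U : {vspace V}, forall v, P v <-> v \in U.
  pose Q d := `[< exists U : {vspace V},
    (forall v, v \in U -> P v) /\ \dim U = d >].
  have exQ : exists d, Q d.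
    exists 0%N; apply/asboolP; exists 0%VS; split; last exact: dimv0.
    by move=> w /vlineP[a ->]; rewrite scaler0.
  have bQ d : Q d -> (d <= \dim {:V})%N.
    by move=> /asboolP[U [_ <-]]; apply: dimvS; exact: subvf.
  case: (ex_maxnP exQ bQ) => d /asboolP[U [UP dU]] maxd.
  exists U => w; split; last exact: UP.
  move=> Pw; have : (\dim (U + <[w]>) <= \dim U)%N.
    rewrite dU; apply: maxd; apply/asboolP; exists (U + <[w]>)%VS; split=> // x.
    by move=> /memv_addP[u Uu [y /vlineP[a ->] ->]]; apply: PD; [apply: UP|apply: PZ].
  move=> le; have /eqP e : U == (U + <[w]>)%VS by rewrite eqEdim addvSl.
  by rewrite e; apply: (subvP (addvSr _ _)); rewrite memv_line.
move=> Pv; apply/PU; apply: (subvP (span_ofS _)) Pv => w.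
by move=> /PU.
Qed.

End Span.

Lemma linfun_linE (F : fieldType) (U V : vectType F) (f : U -> V) :
  linear f -> forall u, linfun f u = f u.
Proof.
move=> f_lin u; pose fL : {linear U -> V} :=
  HB.pack f (GRing.isLinear.Build F _ _ *:%R f f_lin).
exact: (lfunE fL u).
Qed.

Section Tensor.
Variable F : fieldType.
Implicit Types U V W : vectType F.

(* The tensor product is realized as the space of coordinate matrices with  *)
(* respect to the canonical bases of the two factors.                       *)
Definition tensor V W : vectType F := 'M[F]_(\dim {:V}, \dim {:W}).

Definition tens V W (v : V) (w : W) : tensor V W :=
  \matrix_(i, j) (coord (vbasis {:V}) i v * coord (vbasis {:W}) j w).

(* The linear map on the tensor product induced by a bilinear map b.        *)
Definition tens_lift U V W (b : V -> W -> U) : 'Hom(tensor V W, U) :=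
  linfun (fun t : tensor V W =>
    \sum_i \sum_j t i j *: b (vbasis {:V})`_i (vbasis {:W})`_j).

Definition bilin U V W (b : V -> W -> U) :=
  (forall w (a : F) v v', b (a *: v + v') w = a *: b v w + b v' w) /\
  (forall v (a : F) w w', b v (a *: w + w') = a *: b v w + b v w').

Definition tens_map V V' W W' (f : 'Hom(V, V')) (g : 'Hom(W, W')) :
    'Hom(tensor V W, tensor V' W') :=
  tens_lift (fun v w => tens (f v) (g w)).

Definition tensv V W (A : {vspace V}) (B : {vspace W}) : {vspace tensor V W} :=
  span_of (fun t => exists v w, [/\ v \in A, w \in B & t = tens v w]).

Lemma tens_bilin V W : bilin (@tens V W).
Proof.
split=> [w a v v'|v a w w']; apply/matrixP=> i j; rewrite !mxE linearP /=; ring.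
Qed.

Section Bilin.
Variables (U V W : vectType F) (b : V -> W -> U) (bb : bilin b).

Lemma bilin0l w : b 0 w = 0.
Proof. by have := bb.1 w (-1) 0 0; rewrite scaler0 addr0 scaleN1r addNr. Qed.
Lemma bilin0r v : b v 0 = 0.
Proof. by have := bb.2 v (-1) 0 0; rewrite scaler0 addr0 scaleN1r addNr. Qed.
Lemma bilinZl a v w : b (a *: v) w = a *: b v w.
Proof. by rewrite -[a *: v]addr0 bb.1 bilin0l addr0. Qed.
Lemma bilinZr a v w : b v (a *: w) = a *: b v w.
Proof. by rewrite -[a *: w]addr0 bb.2 bilin0r addr0. Qed.
Lemma bilinDl v v' w : b (v + v') w = b v w + b v' w.
Proof. by rewrite -[v]scale1r bb.1 !scale1r. Qed.
Lemma bilinDr v w w' : b v (w + w') = b v w + b v w'.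
Proof. by rewrite -[w]scale1r bb.2 !scale1r. Qed.
Lemma bilin_suml I (r : seq I) (P : pred I) f w :
  b (\sum_(i <- r | P i) f i) w = \sum_(i <- r | P i) b (f i) w.
Proof. by apply: (big_morph (b^~ w)) => [v v'|]; rewrite ?bilinDl ?bilin0l. Qed.
Lemma bilin_sumr I (r : seq I) (P : pred I) f v :
  b v (\sum_(i <- r | P i) f i) = \sum_(i <- r | P i) b v (f i).
Proof. by apply: (big_morph (b v)) => [w w'|]; rewrite ?bilinDr ?bilin0r. Qed.

Lemma tens_liftK t : tens_lift b t =
  \sum_i \sum_j t i j *: b (vbasis {:V})`_i (vbasis {:W})`_j.
Proof.
rewrite /tens_lift linfun_linE // => a u v.
rewrite scaler_sumr -big_split /=; apply: eq_bigr => i _.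
rewrite scaler_sumr -big_split /=; apply: eq_bigr => j _.
by rewrite !mxE scalerDl scalerA.
Qed.

Lemma tens_liftE v w : tens_lift b (tens v w) = b v w.
Proof.
rewrite tens_liftK.
rewrite {2}(coord_vbasis (memvf v)) {2}(coord_vbasis (memvf w)).
rewrite bilin_suml; apply: eq_bigr => i _.
rewrite bilin_sumr; apply: eq_bigr => j _.
by rewrite mxE bilinZl bilinZr scalerA.
Qed.
End Bilin.

Lemma tens_ext U V W (f g : 'Hom(tensor V W, U)) :
  (forall v w, f (tens v w) = g (tens v w)) -> f = g.
Proof.
move=> fg; apply/lfunP=> t.
have -> : t = \sum_i \sum_j t i j *: tens (vbasis {:V})`_i (vbasis {:W})`_j.
  rewrite {1}[t]matrix_sum_delta; apply: eq_bigr => i _; apply: eq_bigr => j _.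
  congr (_ *: _); apply/matrixP=> k l.
  rewrite !mxE !coord_free ?(basis_free (vbasisP _)) //.
  by rewrite -natrM mulnb ![_ == k]eq_sym ![_ == l]eq_sym.
rewrite !linear_sum; apply: eq_bigr => i _.
rewrite !linear_sum; apply: eq_bigr => j _.
by rewrite !linearZ /=; congr (_ *: _); exact: fg.
Qed.

Lemma tens_mapE V V' W W' (f : 'Hom(V, V')) (g : 'Hom(W, W')) v w :
  tens_map f g (tens v w) = tens (f v) (g w).
Proof.
by rewrite tens_liftE //; split=> *; rewrite linearP;
  [rewrite (tens_bilin _ _).1 | rewrite (tens_bilin _ _).2].
Qed.

End Tensor.

(* The left conjugate of h by g; MathComp's h ^ g is g^-1 h g. *)
Definition lconj (gT : groupType) (g h : gT) : gT := (g * h * g^-1)%g.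

Record cocycle3 (F : fieldType) (gT : finGroupType) := Cocycle3 {
  omega_fun :> gT -> gT -> gT -> F;
  omega_neq0 : forall a b c, omega_fun a b c != 0;
  omega_cocycle : forall a b c d : gT,
    omega_fun (a * b)%g c d * omega_fun a b (c * d)%g =
    omega_fun a b c * omega_fun a (b * c)%g d * omega_fun b c d;
  omega_norm : forall a b : gT, omega_fun a 1%g b = 1
}.

Section OmegaDerived.
Variables (F : fieldType) (gT : finGroupType) (w : cocycle3 F gT).
Implicit Types f g h k l : gT.

(* omega(g, g'; h) *)
Definition omega_act g g' h : F :=
  w (lconj (g * g')%g h) g g' * w g g' h / w g (lconj g' h) g'.

(* omega(g; f, h) *)
Definition omega_tens g f h : F :=
  w (lconj g f) g h / (w g f h * w (lconj g f) (lconj g h) g).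

End OmegaDerived.

Record trivialization (F : fieldType) (gT : finGroupType) (w : cocycle3 F gT)
    (H : {group gT}) := Trivialization {
  gamma_fun :> subg_of H -> subg_of H -> F;
  gamma_neq0 : forall a b, gamma_fun a b != 0;
  gamma_cocycle : forall a b c : subg_of H,
    gamma_fun (a * b)%g c * gamma_fun a b / (gamma_fun a (b * c)%g * gamma_fun b c)
    = w (sgval a) (sgval b) (sgval c)
}.

Section OmegaTheory.
Variables (F : fieldType) (gT : finGroupType) (w : cocycle3 F gT).
Implicit Types f g h k l : gT.

Let nz := omega_neq0 w.

Lemma lconjM g h k : lconj (g * h)%g k = lconj g (lconj h k).
Proof. by rewrite /lconj invMg !mulgA. Qed.
Lemma lconj1g h : lconj 1%g h = h.
Proof. by rewrite /lconj invg1 mulg1 mul1g. Qed.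
Lemma lconjMr g h k : lconj g (h * k)%g = (lconj g h * lconj g k)%g.
Proof. by rewrite /lconj !mulgA mulgKV. Qed.
Lemma lconjE g h : (lconj g h * g)%g = (g * h)%g.
Proof. by rewrite /lconj mulgKV. Qed.
Lemma lconj_inj g : injective (lconj g).
Proof. by move=> h k; rewrite /lconj => /mulIg/mulgI. Qed.

Lemma omega1l a b : w 1%g a b = 1.
Proof.
have := omega_cocycle w 1%g 1%g a b.
rewrite !omega_norm !mul1g mulr1 mul1r => E.
by apply: (mulfI (nz 1%g a b)); rewrite -E mulr1.
Qed.

Lemma omega1r a b : w a b 1%g = 1.
Proof.
have := omega_cocycle w a b 1%g 1%g.
rewrite !omega_norm !mulg1 mulr1 mul1r => E.
by apply: (mulfI (nz a b 1%g)); rewrite mulr1 -E.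
Qed.

Lemma omega_act_neq0 g h k : omega_act w g h k != 0.
Proof. by rewrite /omega_act !mulf_neq0 ?invr_eq0. Qed.

Lemma omega_tens_neq0 g h k : omega_tens w g h k != 0.
Proof. by rewrite /omega_tens !mulf_neq0 ?invr_eq0 ?mulf_neq0. Qed.

Let pivr (x y z : F) : x != 0 -> x * y = z -> y = z / x.
Proof. by move=> x0 <-; rewrite mulrAC mulfV ?mul1r. Qed.

Lemma omega_act_cocycle g h k l :
  omega_act w g h (lconj k l) * omega_act w (g * h)%g k l =
  omega_act w h k l * omega_act w g (h * k)%g l.
Proof.
rewrite /omega_act !lconjM.
set C := lconj k l; set B := lconj h C; set A := lconj g B.
have E1 := omega_cocycle w A g h k; have E2 := omega_cocycle w g B h k.
have E3 := omega_cocycle w g h C k; have E4 := omega_cocycle w g h k l.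
rewrite lconjE in E1; rewrite lconjE in E2; rewrite lconjE in E3.
move: (pivr (nz _ _ _) E1) (pivr (nz _ _ _) E2) => {}E1 {}E2.
rewrite mulrC in E3; move: (pivr (nz _ _ _) E3) => {}E3.
rewrite mulrC in E4; move: (pivr (nz _ _ _) E4) => {}E4.
rewrite E1 E2 E3 E4; field; by rewrite !nz.
Qed.

Lemma omega_tens_act g h k l :
  omega_tens w (g * h)%g k l * omega_act w g h k * omega_act w g h l =
  omega_act w g h (k * l)%g * omega_tens w g (lconj h k) (lconj h l)
    * omega_tens w h k l.
Proof.
rewrite /omega_act /omega_tens (lconjMr _ k l) (lconjMr h k l) !lconjM.
set k' := lconj h k; set l' := lconj h l.
set k'' := lconj g k'; set l'' := lconj g l'.
have E1 := omega_cocycle w k'' l'' g h; have E2 := omega_cocycle w k'' g l' h.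
have E3 := omega_cocycle w k'' g h l; have E4 := omega_cocycle w g k' l' h.
have E5 := omega_cocycle w g k' h l; have E6 := omega_cocycle w g h k l.
rewrite lconjE in E1; rewrite !lconjE in E2; rewrite lconjE in E3.
rewrite lconjE in E4; rewrite lconjE in E5.
move: E1 E2 E3 E4 E5 E6.
rewrite [w (_ * l'')%g _ _ * _]mulrC => /(pivr (nz _ _ _)) E1.
move=> /esym/(pivr (mulf_neq0 (nz _ _ _) (nz _ _ _))) E2.
move=> /esym/(pivr (mulf_neq0 (nz _ _ _) (nz _ _ _))) E3.
move=> /esym/(pivr (mulf_neq0 (nz _ _ _) (nz _ _ _))) E4.
move=> /esym/(pivr (mulf_neq0 (nz _ _ _) (nz _ _ _))) E5.
move=> /esym/(pivr (mulf_neq0 (nz _ _ _) (nz _ _ _))) E6.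
rewrite E1 E2 E3 E4 E5 E6; field; by rewrite !nz.
Qed.

Lemma omega_act1 k : omega_act w 1%g 1%g k = 1.
Proof. by rewrite /omega_act !omega_norm omega1r !mulr1 divr1. Qed.

Lemma omega_act_1 g h : omega_act w g h 1%g = 1.
Proof. by rewrite /omega_act /lconj !mulg1 !mulgV omega1l omega1r omega_norm mulr1 divr1. Qed.

Lemma omega_tens1 f h : omega_tens w 1%g f h = 1.
Proof.
by rewrite /omega_tens !lconj1g !omega_norm omega1l omega1r mulr1 divr1.
Qed.

End OmegaTheory.

(* directv also flattens nested sums that it can see by unfolding, so the    *)
(* pieces are abstracted into the variable c here.                          *)
Definition is_grading (F : fieldType) (gT : finGroupType) (V : vectType F)
    (c : gT -> {vspace V}) : Prop :=
  fullv = (\sum_g c g)%VS /\ directv (\sum_g c g).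

Record grading (F : fieldType) (gT : finGroupType) (V : vectType F) := Grading {
  gcomp :> gT -> {vspace V};
  gcompP : is_grading gcomp
}.

Section Grading.
Variables (F : fieldType) (gT : finGroupType) (V : vectType F).

Definition gproj (gr : grading gT V) (g : gT) : 'End(V) :=
  sumv_pi_for (gcompP gr).1 g.

Implicit Types gr : grading gT V.

Lemma gproj_mem gr g v : gproj gr g v \in gr g.
Proof. exact: memv_sum_pi. Qed.

Lemma gproj_sum gr v : \sum_g gproj gr g v = v.
Proof. by rewrite sumv_pi_sum // memvf. Qed.

Lemma gproj_comp gr g h v : v \in gr h ->
  gproj gr g v = if g == h then v else 0.
Proof.
move=> Vv; have /directv_sum_unique := (gcompP gr).2.
move=> /(_ (fun g => gproj gr g v) (fun g => if g == h then v else 0)).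
have U1 k : true -> gproj gr k v \in gr k by move=> _; exact: gproj_mem.
have U2 k : true -> (if k == h then v else 0) \in gr k.
  by case: eqP => [->//|_]; rewrite mem0v.
move=> /(_ U1 U2); rewrite gproj_sum -big_mkcond big_pred1_eq eqxx.
by move=> /esym/forall_inP/(_ g isT)/eqP.
Qed.

Lemma grading_of_proj (c : gT -> {vspace V}) (p : gT -> V -> V) :
  (forall g v, p g v \in c g) ->
  (forall g h v, v \in c h -> p g v = if g == h then v else 0) ->
  (forall g, {morph p g : u v / u + v}) ->
  (forall v, \sum_g p g v = v) ->
  is_grading c.
Proof.
move=> pc pE pD pS; split.
  apply/eqP; rewrite eq_sym eqEsubv subvf /=; apply/subvP=> v _.
  by rewrite -[v]pS; apply: memv_sumr => g _; exact: pc.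
apply/directv_sum_independent => us Uu u0 g _.
have p0 : p g 0 = 0 by rewrite (pE g g) ?mem0v // eqxx.
have := congr1 (p g) u0.
rewrite (big_morph _ (pD g) p0) p0 (bigD1 g) //= (pE _ _ _ (Uu g isT)) eqxx.
rewrite big1 ?addr0 // => h hg.
by rewrite (pE _ _ _ (Uu h isT)) eq_sym (negbTE hg).
Qed.

End Grading.

Record zobj (F : fieldType) (gT : finGroupType) (w : cocycle3 F gT) := ZObj {
  zcar :> vectType F;
  zdeg : grading gT zcar;
  zact : gT -> 'End(zcar);
  zact1 : forall v, zact 1%g v = v;
  zactM : forall g h k v, v \in zdeg k ->
    zact (g * h)%g v = omega_act w g h k *: zact g (zact h v);
  zact_deg : forall g h v, v \in zdeg h -> zact g v \in zdeg (lconj g h)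
}.
Arguments zdeg {F gT w}.
Arguments zact {F gT w}.

Section Category.
Variables (F : fieldType) (gT : finGroupType) (w : cocycle3 F gT).
Implicit Types (V W Z : zobj w) (g h k l : gT).

Definition hpart V g : 'End(V) := gproj (zdeg V) g.

Definition is_zmor V W (f : 'Hom(V, W)) :=
  (forall g v, v \in zdeg V g -> f v \in zdeg W g) /\
  (forall g v, f (zact V g v) = zact W g (f v)).

Definition zHom V W : {vspace 'Hom(V, W)} := span_of (@is_zmor V W).

Lemma zHomP V W f : (f \in zHom V W) <-> is_zmor f.
Proof.
apply: span_ofP; split=> [|a u v [ud ue] [vd ve]]; split=> g x.
- by rewrite lfunE mem0v.
- by rewrite !lfunE /= linear0.
- by move=> xg; rewrite !lfunE /= lfunE memvD ?memvZ ?ud ?vd.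
- by rewrite !lfunE /= !lfunE /= ue ve linearP.
Qed.

Definition unit_comp g : {vspace F^o} := if g == 1%g then fullv else 0%VS.

Lemma unit_gradingP : is_grading unit_comp.
Proof.
apply: (grading_of_proj (p := fun g v => if g == 1%g then v else 0)).
- by move=> g v; rewrite /unit_comp; case: eqP; rewrite ?memvf ?mem0v.
- move=> g h v; rewrite /unit_comp; have [->|hN] := eqVneq h 1%g; first by [].
  by rewrite memv0 => /eqP->; rewrite !if_same.
- by move=> g u v; case: eqP; rewrite ?addr0.
- by move=> v; rewrite -big_mkcond big_pred1_eq.
Qed.

Definition unit_grading := Grading unit_gradingP.

Definition unit_act (g : gT) : 'End(F^o) := \1%VF.

Lemma unit_act1 v : unit_act 1%g v = v.
Proof. by rewrite id_lfunE. Qed.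

Lemma unit_actM g h k v : v \in unit_grading k ->
  unit_act (g * h)%g v = omega_act w g h k *: unit_act g (unit_act h v).
Proof.
rewrite /= /unit_comp; have [->|hN] := eqVneq k 1%g.
  by rewrite !id_lfunE omega_act_1 scale1r.
by rewrite memv0 => /eqP->; rewrite !id_lfunE scaler0.
Qed.

Lemma unit_act_deg g h v : v \in unit_grading h ->
  unit_act g v \in unit_grading (lconj g h).
Proof.
rewrite id_lfunE /= /unit_comp; have [->|hN] := eqVneq h 1%g.
  by rewrite /lconj mulg1 mulgV eqxx.
by rewrite memv0 => /eqP->; rewrite mem0v.
Qed.

Definition zunit : zobj w := ZObj unit_act1 unit_actM unit_act_deg.

Section Ztensor.
Variables V W : zobj w.

Definition tensor_comp g : {vspace tensor V W} :=
  (\sum_h tensv (zdeg V h) (zdeg W (h^-1 * g)%g))%VS.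

Definition tensor_act h : 'End(tensor V W) :=
  tens_lift (fun v v' => \sum_g \sum_l
    omega_tens w h g l *:
      tens (zact V h (hpart V g v)) (zact W h (hpart W l v'))).

Let tensor_proj_fun g (v : V) (v' : W) : tensor V W :=
  \sum_h tens (hpart V h v) (hpart W (h^-1 * g)%g v').

Let tensor_proj_bilin g : bilin (tensor_proj_fun g).
Proof.
split=> [v' a v u|v a v' u']; rewrite /tensor_proj_fun scaler_sumr -big_split /=;
  apply: eq_bigr => h _; rewrite linearP.
  by rewrite (tens_bilin _ _).1.
by rewrite (tens_bilin _ _).2.
Qed.

Lemma tensor_act_bilin h : bilin (fun (v : V) (v' : W) => \sum_g \sum_l
    omega_tens w h g l *:
      tens (zact V h (hpart V g v)) (zact W h (hpart W l v'))).
Proof.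
split=> [v' a v u|v a v' u']; rewrite scaler_sumr -big_split /=;
  apply: eq_bigr => g _; rewrite scaler_sumr -big_split /=;
  apply: eq_bigr => l _; rewrite !linearP.
  by rewrite (tens_bilin _ _).1 scalerDr !scalerA [a * _]mulrC.
by rewrite (tens_bilin _ _).2 scalerDr !scalerA [a * _]mulrC.
Qed.

Lemma hpartE (X : zobj w) g h (v : X) : v \in zdeg X h ->
  hpart X g v = if g == h then v else 0.
Proof. exact: gproj_comp. Qed.

Lemma tensor_compP g h (v : V) (v' : W) : v \in zdeg V g -> v' \in zdeg W h ->
  tens v v' \in tensor_comp (g * h)%g.
Proof.
move=> vg vh; rewrite /tensor_comp.
apply: (subvP (sumv_sup g _ (subvv _))) => //.
by apply: mem_span_of; exists v, v'; rewrite mulKg.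
Qed.

Lemma tensor_comp_ind g (U : {vspace tensor V W}) :
  (forall h l v v', v \in zdeg V h -> v' \in zdeg W l -> (h * l)%g = g ->
     tens v v' \in U) -> (tensor_comp g <= U)%VS.
Proof.
move=> HU; apply/subv_sumP=> h _; apply: span_ofS => t [v [v' [vh vl ->]]].
by apply: HU vh vl _; rewrite mulKVg.
Qed.

Lemma tensor_decomp (v : V) (v' : W) :
  tens v v' = \sum_g \sum_h tens (hpart V g v) (hpart W h v').
Proof.
rewrite -{1}[v](gproj_sum (zdeg V)) (bilin_suml (tens_bilin _ _)).
apply: eq_bigr => g _; rewrite -{1}[v'](gproj_sum (zdeg W)).
by rewrite (bilin_sumr (tens_bilin _ _)).
Qed.

Lemma tensor_actE h g l (v : V) (v' : W) : v \in zdeg V g -> v' \in zdeg W l ->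
  tensor_act h (tens v v') = omega_tens w h g l *: tens (zact V h v) (zact W h v').
Proof.
move=> vg vl; rewrite tens_liftE; last exact: tensor_act_bilin.
have [b0l b0r] := (bilin0l (tens_bilin V W), bilin0r (tens_bilin V W)).
rewrite (bigD1 g) //= [X in _ + X]big1 ?addr0 => [|g' g'g]; last first.
  rewrite big1 // => l' _.
  by rewrite (hpartE _ vg) (negbTE g'g) linear0 b0l scaler0.
rewrite (bigD1 l) //= big1 ?addr0 => [|l' l'l]; last first.
  by rewrite (hpartE _ vl) (negbTE l'l) linear0 b0r scaler0.
by rewrite (hpartE _ vg) (hpartE _ vl) !eqxx.
Qed.

Lemma tensor_gradingP :
  is_grading tensor_comp.
Proof.
pose p g := tens_lift (tensor_proj_fun g).
have pE g (v : V) (v' : W) : p g (tens v v') = tensor_proj_fun g v v'.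
  by rewrite tens_liftE.
have pH g h l (v : V) (v' : W) : v \in zdeg V h -> v' \in zdeg W l ->
    p g (tens v v') = if g == (h * l)%g then tens v v' else 0.
  move=> vh vl; rewrite pE /tensor_proj_fun (bigD1 h) //= big1 ?addr0.
    rewrite (hpartE _ vh) (hpartE _ vl) eqxx.
    rewrite -(inj_eq (mulgI h)) mulKVg; case: eqP => // _.
    by rewrite (bilin0r (tens_bilin _ _)).
  move=> k kh; rewrite (hpartE _ vh) (negbTE kh).
  by rewrite (bilin0l (tens_bilin _ _)).
apply: (grading_of_proj (p := fun g t => p g t)).
- move=> g t; suff /subvP : (limg (p g) <= tensor_comp g)%VS.
    by apply; apply: memv_img; exact: memvf.
  apply/subvP=> _ /memv_imgP[u _ ->].
  rewrite /p tens_liftK; apply: memv_suml => i _; apply: memv_suml => j _.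
  apply: memvZ; apply: memv_suml => h _.
  by rewrite -[g in tensor_comp g](mulKVg h); apply: tensor_compP; exact: gproj_mem.
- move=> g h t th.
  pose q : 'End(tensor V W) := p g - (if g == h then \1%VF else 0).
  suff /subvP/(_ _ th) : (tensor_comp h <= lker q)%VS.
    rewrite memv_ker add_lfunE opp_lfunE subr_eq0 => /eqP->.
    by case: eqP => _; rewrite ?id_lfunE ?zero_lfunE.
  apply: tensor_comp_ind => k l v v' vk vl kl.
  rewrite /q -kl memv_ker add_lfunE opp_lfunE subr_eq0 (pH _ _ _ _ _ vk vl).
  by case: (g == _); rewrite ?id_lfunE ?zero_lfunE eqxx.
- by move=> g u v; rewrite linearD.
- move=> t; rewrite -sum_lfunE -[RHS]id_lfunE; apply: (congr1 (fun f => fun_of_lfun f t)).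
  apply: tens_ext => v v'; rewrite sum_lfunE id_lfunE.
  rewrite [RHS]tensor_decomp; under eq_bigr do rewrite pE /tensor_proj_fun.
  rewrite exchange_big /=; apply: eq_bigr => h _.
  by rewrite (reindex_inj (mulgI h)) /=; apply: eq_bigr => l _; rewrite mulKg.
Qed.

Definition tensor_grading := Grading tensor_gradingP.

Lemma tensor_act1 v : tensor_act 1%g v = v.
Proof.
rewrite -[RHS]id_lfunE; apply: (congr1 (fun f => fun_of_lfun f v)).
apply: tens_ext => {}v v'.
rewrite id_lfunE tens_liftE; last exact: tensor_act_bilin.
rewrite [RHS]tensor_decomp; apply: eq_bigr => g _; apply: eq_bigr => l _.
by rewrite omega_tens1 scale1r !zact1.
Qed.

Lemma tensor_actM g h k v : v \in tensor_grading k ->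
  tensor_act (g * h)%g v = omega_act w g h k *: tensor_act g (tensor_act h v).
Proof.
move=> vk; pose q : 'End(tensor V W) :=
  tensor_act (g * h)%g - omega_act w g h k *: (tensor_act g \o tensor_act h)%VF.
suff /subvP/(_ _ vk) : (tensor_comp k <= lker q)%VS.
  rewrite memv_ker add_lfunE opp_lfunE subr_eq0 => /eqP->.
  by rewrite scale_lfunE comp_lfunE.
apply: tensor_comp_ind => {v vk} a b v v' va vb ab.
rewrite /q -ab memv_ker add_lfunE opp_lfunE subr_eq0 scale_lfunE comp_lfunE.
rewrite !(tensor_actE _ va vb) linearZ /=.
rewrite (tensor_actE _ (zact_deg h va) (zact_deg h vb)).
rewrite (zactM _ _ va) (zactM _ _ vb).
rewrite (bilinZl (tens_bilin _ _)) (bilinZr (tens_bilin _ _)) !scalerA.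
by rewrite mulrA omega_tens_act mulrAC.
Qed.

Lemma tensor_act_deg g h v : v \in tensor_grading h ->
  tensor_act g v \in tensor_grading (lconj g h).
Proof.
move=> vh; suff /subvP/(_ _ vh) : (tensor_comp h <=
    tensor_act g @^-1: tensor_comp (lconj g h))%VS by rewrite -memv_preim.
apply: tensor_comp_ind => {v vh} a b v v' va vb <-.
rewrite -memv_preim (tensor_actE _ va vb) memvZ // lconjMr.
by apply: tensor_compP; exact: zact_deg.
Qed.

Definition ztens : zobj w := ZObj tensor_act1 tensor_actM tensor_act_deg.

End Ztensor.

Definition zassoc V W Z : 'Hom(ztens (ztens V W) Z, ztens V (ztens W Z)) :=
  tens_lift (fun (t : tensor V W) (z : Z) =>
    tens_lift (fun (v : V) (v' : W) => \sum_g \sum_h \sum_k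
      w g h k *: (tens (hpart V g v) (tens (hpart W h v') (hpart Z k z) : ztens W Z)
                  : ztens V (ztens W Z))) t).

Definition zbraid V W : 'Hom(ztens V W, ztens W V) :=
  tens_lift (fun (v : V) (v' : W) => \sum_g tens (zact W g v') (hpart V g v)).

(* V^(x)n, parenthesized from the left; V^(x)0 is the unit object.          *)
Fixpoint tpow V n : zobj w :=
  match n with
  | 0 => zunit
  | m.+1 => match m with 0 => V | _ => ztens (tpow V m) V end
  end.

(* sigma'_i on V^(x)n.  For i = 1 the factor V^(x)(i-1) is the unit object,  *)
(* which is strict, so that sigma'_1 is the braiding of the first two        *)
(* factors. The value is irrelevant unless 1 <= i < n.                       *)
Definition sigma_last V m : 'End(tpow V m.+2) :=
  match m return 'End(tpow V m.+2) with
  | 0 => zbraid V V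
  | p.+1 =>
    ((zassoc (tpow V p.+1) V V)^-1
      \o (tens_map \1 (zbraid V V) : 'End(ztens (tpow V p.+1) (ztens V V)))
      \o zassoc (tpow V p.+1) V V)%VF
  end.

Fixpoint sigma V n i : 'End(tpow V n) :=
  match n return 'End(tpow V n) with
  | 0 => \1%VF
  | m.+1 =>
    match m return 'End(tpow V m) -> 'End(tpow V m.+1) with
    | 0 => fun _ => \1%VF
    | p.+1 => fun s => if i == p.+1 then sigma_last V p else tens_map s \1%VF
    end (sigma V m i)
  end.

Fixpoint tprod V n : ('I_n -> V) -> tpow V n :=
  match n return ('I_n -> V) -> tpow V n with
  | 0 => fun _ => (1 : F^o)
  | m.+1 =>
    match m return (('I_m -> V) -> tpow V m) -> ('I_m.+1 -> V) -> tpow V m.+1 with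
    | 0 => fun _ v => v ord0
    | p.+1 => fun rec v => tens (rec (fun i => v (widen_ord (leqnSn _) i))) (v ord_max)
    end (@tprod V m)
  end.

Section Subobject.
Variables (V : zobj w) (U : {vspace V}).
Hypothesis U_graded : forall g v, v \in U -> hpart V g v \in U.
Hypothesis U_stable : forall g v, v \in U -> zact V g v \in U.

Definition sub_comp g : {vspace subvs_of U} := (linfun vsval @^-1: zdeg V g)%VS.
Definition sub_act g : 'End(subvs_of U) :=
  linfun (vsproj U \o zact V g \o vsval).

Lemma mem_sub_comp g u : (u \in sub_comp g) = (vsval u \in zdeg V g).
Proof. by rewrite -memv_preim lfunE. Qed.

Lemma sub_actE g u : vsval (sub_act g u) = zact V g (vsval u).
Proof. by rewrite lfunE /= vsprojK //; apply: U_stable; exact: subvsP. Qed.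

Lemma sub_gradingP : is_grading sub_comp.
Proof.
have pE g (u : subvs_of U) : vsval (vsproj U (hpart V g (vsval u))) = hpart V g (vsval u).
  by rewrite vsprojK //; apply: U_graded; exact: subvsP.
apply: (grading_of_proj (p := fun g u => vsproj U (hpart V g (vsval u)))).
- by move=> g u; rewrite mem_sub_comp pE; exact: gproj_mem.
- move=> g h u; rewrite mem_sub_comp => uh; apply: val_inj; rewrite [LHS]pE.
  by rewrite (hpartE _ uh); case: eqP.
- by move=> g u v; rewrite !linearD.
- move=> u; apply: val_inj; rewrite /= linear_sum /=.
  under eq_bigr do rewrite pE; exact: gproj_sum.
Qed.

Definition sub_grading := Grading sub_gradingP.

Lemma sub_act1 u : sub_act 1%g u = u.
Proof. by apply: val_inj; rewrite [LHS]sub_actE zact1. Qed.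

Lemma sub_actM g h k u : u \in sub_grading k ->
  sub_act (g * h)%g u = omega_act w g h k *: sub_act g (sub_act h u).
Proof.
rewrite /= mem_sub_comp => uk; apply: val_inj.
by rewrite [LHS]sub_actE (zactM _ _ uk) /= !sub_actE.
Qed.

Lemma sub_act_deg g h u : u \in sub_grading h ->
  sub_act g u \in sub_grading (lconj g h).
Proof. by rewrite /= !mem_sub_comp sub_actE; exact: zact_deg. Qed.

Definition zsub : zobj w := ZObj sub_act1 sub_actM sub_act_deg.

End Subobject.

End Category.

Section Lagrangian.
Variables (F : fieldType) (gT : finGroupType) (w : cocycle3 F gT).
Variables (H : {group gT}) (gamma : trivialization w H).
Local Notation HT := (subg_of H).
Implicit Types (x g f k : gT) (h : HT).

Definition eps (h1 h2 : HT) : F := gamma h1 h2 / gamma (lconj h1 h2) h1.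

Definition CH : vectType F := {ffun HT -> F^o}.
Definition ebas h : CH := [ffun k => (k == h)%:R].
Definition CH_comp g : {vspace CH} := (\sum_(h : HT | sgval h == g) <[ebas h]>)%VS.
Definition CH_act h : 'End(CH) :=
  linfun (fun v : CH => \sum_k (v k * eps h k) *: ebas (lconj h k)).

Lemma CH_actE h v : CH_act h v = \sum_k (v k * eps h k) *: ebas (lconj h k).
Proof.
apply: (linfun_linE (f := fun v : CH => \sum_k (v k * eps h k) *: ebas (lconj h k))).
move=> a u u'; rewrite scaler_sumr -big_split /=; apply: eq_bigr => k _.
by rewrite !ffunE mulrDl scalerDl scalerA -[a *: u k]/(a * u k) -[in LHS]mulrA.
Qed.

Lemma CH_act_ebas (h k : HT) : CH_act h (ebas k) = eps h k *: ebas (lconj h k).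
Proof.
rewrite CH_actE (bigD1 k) //= big1 => [|l lk].
  by rewrite ffunE eqxx mul1r addr0.
by rewrite ffunE (negbTE lk) mul0r scale0r.
Qed.

Lemma mem_CH_comp g (v : CH) :
  (v \in CH_comp g) <-> (forall h, sgval h != g -> v h = 0).
Proof.
split=> [/memv_sumP[u Hu ->] h hg|Hv].
  rewrite sum_ffunE big1 // => k kg; have /vlineP[a ->] := Hu k kg.
  rewrite !ffunE; have [E|_] := eqVneq h k; last by rewrite scaler0.
  by rewrite E kg in hg.
have -> : v = \sum_(h : HT | sgval h == g) v h *: ebas h.
  apply/ffunP=> h; rewrite sum_ffunE.
  have [hg|hg] := boolP (sgval h == g).
    rewrite (bigD1 h) //= big1 => [|k /andP[_ kh]].
      by rewrite !ffunE eqxx addr0 /GRing.scale /= mulr1.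
    by rewrite !ffunE eq_sym (negbTE kh) scaler0.
  rewrite Hv // big1 // => k kg; rewrite !ffunE; case: eqP => [E|_].
    by rewrite E kg in hg.
  by rewrite scaler0.
by apply: memv_sumr => h _; rewrite memvZ ?memv_line.
Qed.

Definition maps : vectType F := {ffun gT -> CH}.

Definition maps_homog f (a : maps) := forall x, a x \in CH_comp (x^-1 * f * x)%g.

Definition maps_comp f : {vspace maps} := span_of (maps_homog f).

Lemma maps_compP f a : (a \in maps_comp f) <-> maps_homog f a.
Proof.
apply: span_ofP; split=> [x|c u v Hu Hv x]; first by rewrite ffunE mem0v.
by rewrite !ffunE memvD ?memvZ.
Qed.

Lemma maps_gradingP : is_grading maps_comp.
Proof.
pose p f (a : maps) : maps :=
  [ffun x => [ffun h => if sgval h == (x^-1 * f * x)%g then a x h else 0]].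
apply: (grading_of_proj (p := p)).
- move=> f a; apply/maps_compP=> x; apply/mem_CH_comp=> h hf.
  by rewrite !ffunE (negbTE hf).
- move=> g f a /maps_compP af; apply/ffunP=> x; apply/ffunP=> h.
  have /mem_CH_comp/(_ h) afx := af x.
  rewrite !ffunE; case: eqP => [hg|/eqP hg]; case: eqP => [gf|/eqP gf] //.
  - rewrite !ffunE afx // hg; apply: contra gf => /eqP/mulIg/mulgI ->.
    by rewrite eqxx.
  - by rewrite afx // -gf.
  - by rewrite !ffunE.
- by move=> f u v; apply/ffunP=> x; apply/ffunP=> h; rewrite !ffunE; case: eqP;
    rewrite ?addr0.
- move=> a; apply/ffunP=> x; apply/ffunP=> h; rewrite !sum_ffunE.
  rewrite (bigD1 (x * sgval h * x^-1)%g) //= big1 ?addr0 => [|f fN].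
    by rewrite !ffunE !mulgA mulVg mul1g mulgKV eqxx.
  rewrite !ffunE; case: eqP => // E; case/eqP: fN.
  by rewrite E !mulgA mulgV mul1g mulgK.
Qed.

Definition maps_grading := Grading maps_gradingP.

Definition maps_act g : 'End(maps) := linfun (fun a : maps =>
  [ffun x => \sum_f (omega_act w x^-1%g g f)^-1 *:
                      gproj maps_grading f a (g^-1 * x)%g]).

Lemma maps_actE g f a x : a \in maps_grading f ->
  maps_act g a x = (omega_act w x^-1%g g f)^-1 *: a (g^-1 * x)%g.
Proof.
move=> af.
rewrite /maps_act linfun_linE => [|c u v]; last first.
  apply/ffunP=> y; rewrite !ffunE scaler_sumr -big_split /=.
  apply: eq_bigr => k _; rewrite linearP !ffunE scalerDr !scalerA.
  by rewrite [c * _]mulrC.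
rewrite ffunE (bigD1 f) //= big1 ?addr0 => [|k kf].
  by rewrite (gproj_comp _ af) eqxx.
by rewrite (gproj_comp _ af) (negbTE kf) ffunE scaler0.
Qed.

Lemma maps_act_deg g f a : a \in maps_grading f ->
  maps_act g a \in maps_grading (lconj g f).
Proof.
move=> af; apply/maps_compP=> x; rewrite (maps_actE _ _ af) memvZ //.
have /maps_compP/(_ (g^-1 * x)%g) := af.
by rewrite invMg invgK /lconj !mulgA.
Qed.

Lemma maps_act1 a : maps_act 1%g a = a.
Proof.
rewrite -[a in RHS](gproj_sum maps_grading) -{1}[a](gproj_sum maps_grading).
rewrite linear_sum; apply: eq_bigr => f _; apply/ffunP=> x.
rewrite (maps_actE _ _ (gproj_mem _ _ _)) invg1 mul1g /omega_act.
by rewrite omega_norm !omega1r mulr1 divr1 invr1 scale1r.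
Qed.

Lemma maps_actM g k f a : a \in maps_grading f ->
  maps_act (g * k)%g a = omega_act w g k f *: maps_act g (maps_act k a).
Proof.
move=> af; apply/ffunP=> x; rewrite ffunE (maps_actE _ _ af).
rewrite (maps_actE _ _ (maps_act_deg _ af)) (maps_actE _ _ af) !scalerA.
rewrite !invMg !mulgA invgK; congr (_ *: _).
have nz := omega_act_neq0 w.
have E := omega_act_cocycle w x^-1%g g k f.
apply: (mulfI (nz x^-1%g (g * k)%g f)); rewrite mulfV //.
by rewrite mulrA [X in X * _]mulrC -E -invfM mulfV // mulf_neq0.
Qed.

Definition zmaps : zobj w := ZObj maps_act1 maps_actM maps_act_deg.

Definition L_cond f (a : zmaps) :=
  a \in zdeg zmaps f /\
  forall x h, (a : maps) (x * sgval h)%g =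
    omega_act w (sgval h)^-1%g x^-1%g f *: CH_act h^-1%g ((a : maps) x).

Definition L_space : {vspace zmaps} := span_of (fun a => exists f, L_cond f a).

Lemma L_graded g a : a \in L_space -> hpart zmaps g a \in L_space.
Proof.
move=> aL; suff /subvP/(_ _ aL) : (L_space <= hpart zmaps g @^-1: L_space)%VS.
  by rewrite -memv_preim.
apply: span_ofS => b [f bf]; rewrite -memv_preim (hpartE _ bf.1).
by case: eqP => _; [apply: mem_span_of; exists f | exact: mem0v].
Qed.

Lemma L_stable g a : a \in L_space -> zact zmaps g a \in L_space.
Proof.
move=> aL; suff /subvP/(_ _ aL) : (L_space <= zact zmaps g @^-1: L_space)%VS.
  by rewrite -memv_preim.
apply: span_ofS => b [f [bf bL]]; rewrite -memv_preim; apply: mem_span_of.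
exists (lconj g f); split; first exact: zact_deg.
move=> x h; rewrite /= !(maps_actE _ _ bf) mulgA bL !linearZ /= !scalerA.
congr (_ *: _).
have := omega_act_cocycle w (sgval h)^-1%g x^-1%g g f.
rewrite !invMg invgK => E.
have nz := omega_act_neq0 w.
rewrite [RHS]mulrC; apply/eqP; rewrite eqr_div ?nz //.
by rewrite mulrC -E.
Qed.

Definition Lalg : zobj w := zsub L_graded L_stable.

Definition chi_fun g (f : HT) : zmaps :=
  [ffun x => if (g^-1 * x)%g \in H then
     let h := subg H (g^-1 * x)%g in
     (omega_act w (sgval h)^-1%g g^-1%g (lconj g (sgval f)) * eps h^-1%g f)
       *: ebas (lconj h^-1%g f)
   else 0].

Lemma eps_act (a b c : HT) :
  eps (a * b)%g c =
  omega_act w (sgval a) (sgval b) (sgval c) * eps a (lconj b c) * eps b c.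
Proof.
rewrite /omega_act /eps !lconjM; set c' := lconj b c; set c'' := lconj a c'.
have nzg := gamma_neq0 gamma; have nz := omega_neq0 w.
have gE (p q r : HT) : gamma (p * q)%g r * gamma p q =
    w (sgval p) (sgval q) (sgval r) * (gamma p (q * r)%g * gamma q r).
  by rewrite -(gamma_cocycle gamma) divfK // mulf_neq0.
have E1 := gE a b c; have E2 := gE a c' b; have E3 := gE c'' a b.
rewrite lconjE in E2; rewrite lconjE in E3.
have {}E1 : gamma (a * b)%g c = w (sgval a) (sgval b) (sgval c)
    * (gamma a (b * c)%g * gamma b c) / gamma a b by rewrite -E1 mulfK.
have {}E2 : gamma a c' = w (sgval a) (sgval c') (sgval b)
    * (gamma a (b * c)%g * gamma c' b) / gamma (a * c')%g b.
  by rewrite -E2 mulrAC mulfV ?mul1r.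
have {}E3 : gamma c'' (a * b)%g = gamma (a * c')%g b * gamma c'' a
    / (w (sgval c'') (sgval a) (sgval b) * gamma a b).
  by rewrite E3; field; rewrite nz nzg.
have -> : lconj (sgval a) (lconj (sgval b) (sgval c)) = sgval c'' by [].
have -> : lconj (sgval b) (sgval c) = sgval c' by [].
by rewrite E1 E2 E3; field; rewrite ?nz ?nzg.
Qed.

Lemma chi_L_cond g (f : HT) : L_cond (lconj g (sgval f)) (chi_fun g f).
Proof.
split.
  apply/maps_compP=> x; rewrite ffunE; case: ifP => [xH|_]; last exact: mem0v.
  apply/memvZ/mem_CH_comp => h hN; rewrite ffunE; case: eqP => // E.
  case/eqP: hN; rewrite E /lconj invgK.
  transitivity ((sgval (subg H (g^-1 * x)))^-1 * sgval f
                * sgval (subg H (g^-1 * x)))%g; first by [].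
  by rewrite subgK // invMg invgK !mulgA.
move=> x h; rewrite !ffunE mulgA groupMr ?subgP //.
case: ifP => xH; last by rewrite linear0 scaler0.
set k := subg H (g^-1 * x).
have kE : sgval k = (g^-1 * x)%g by rewrite /k subgK.
have -> : subg H (g^-1 * x * sgval h) = (k * h)%g.
  apply: val_inj; transitivity (sgval k * sgval h)%g; last by [].
  by rewrite kE [LHS]subgK // groupM ?subgP.
have xE : x^-1%g = ((sgval k)^-1 * g^-1)%g.
  by rewrite -invMg kE mulKVg.
have khV : ((k * h)^-1 = h^-1 * k^-1)%g by rewrite invMg.
have khs : ((sgval (k * h))^-1 = (sgval h)^-1 * (sgval k)^-1)%g.
  by rewrite -invMg.
cbv zeta; rewrite khs khV linearZ /= CH_act_ebas !scalerA -lconjM.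
congr (_ *: _); rewrite eps_act xE.
have := omega_act_cocycle w (sgval h)^-1%g (sgval k)^-1%g g^-1%g (lconj g (sgval f)).
rewrite -(lconjM g^-1 g) mulVg lconj1g => E.
transitivity (omega_act w (sgval h)^-1%g (sgval k)^-1%g (sgval f) *
   omega_act w ((sgval h)^-1 * (sgval k)^-1)%g g^-1%g (lconj g (sgval f)) *
   (eps h^-1%g (lconj k^-1%g f) * eps k^-1%g f)).
  by rewrite /=; ring.
by rewrite E; ring.
Qed.

Lemma chi_mem g (f : HT) : chi_fun g f \in L_space.
Proof.
by apply: mem_span_of; exists (lconj g (sgval f)); exact: chi_L_cond.
Qed.

Definition chi g (f : HT) : Lalg := Subvs (chi_mem g f).

Definition H_orbit (p : gT * HT) : {set gT * HT} :=
  [set ((p.1 * (sgval h)^-1)%g, lconj h p.2) | h : HT].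

Definition GxHH : {set {set gT * HT}} := [set H_orbit p | p : gT * HT].

Definition represents n (p : 'I_n -> gT * HT) (t : {ffun 'I_n -> {set gT * HT}}) :=
  forall i, p i \in t i.

Definition GxHH_e n : {set {ffun 'I_n -> {set gT * HT}}} :=
  [set t : {ffun 'I_n -> {set gT * HT}} | [forall i, t i \in GxHH] &&
    `[< exists p : 'I_n -> gT * HT, represents p t /\
        (\prod_i ((p i).1 * sgval (p i).2 * (p i).1^-1))%g = 1%g >]].

Definition left_act n g (t : {ffun 'I_n -> {set gT * HT}}) :
    {ffun 'I_n -> {set gT * HT}} :=
  [ffun i => [set ((g * p.1)%g, p.2) | p in t i]].

(* The line C chi_{g_1,h_1} (x) ... (x) chi_{g_n,h_n}. Another choice of      *)
(* representatives only rescales this vector, so the span below is a line.  *)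
Definition chi_line n (t : {ffun 'I_n -> {set gT * HT}}) : {vspace tpow Lalg n} :=
  span_of (fun u => exists p : 'I_n -> gT * HT, represents p t /\
    u = tprod (fun i => chi (p i).1 (p i).2)).

End Lagrangian.

Section Monomial.
Variables (F : fieldType) (V : vectType F).

Definition monomial_space (X : finType) (line : X -> {vspace V}) : Prop :=
  (forall x, \dim (line x) = 1%N) /\
  fullv = (\sum_x line x)%VS /\ directv (\sum_x line x).

Definition representation (Gam : groupType) (rho : Gam -> 'End(V)) : Prop :=
  rho 1%g = \1%VF /\ forall a b, rho (a * b)%g = (rho a \o rho b)%VF.

Definition monomial_rep (Gam : groupType) (rho : Gam -> 'End(V))
    (X : finType) (line : X -> {vspace V}) : Prop :=
  [/\ monomial_space line, representation rho &
    forall a, exists s : {perm X}, forall x, (rho a @: line x)%VS = line (s x)].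

Definition regular (Gam X : Type) (rho : Gam -> 'End(V)) (act : Gam -> X -> X)
    (line : X -> {vspace V}) (x : X) : Prop :=
  forall a, act a x = x -> forall v, v \in line x -> rho a v = v.

End Monomial.

Definition regular_orbits (F : fieldType) (gT : finGroupType) (w : cocycle3 F gT)
    (H : {group gT}) (gamma : trivialization w H) (n : nat) :
    {set {set {ffun 'I_n -> {set gT * subg_of H}}}} :=
  [set [set left_act g t | g : gT] | t in GxHH_e H n &
    `[< regular (zact (tpow (Lalg gamma) n)) (@left_act gT H n)
          (@chi_line F gT w H gamma n) t >]].

(* Words in the generators: (i, false) stands for sigma_{i+1} and (i, true)  *)
(* for its inverse, 0 <= i < n - 1.                                         *)
Definition braid_word (n : nat) := seq ('I_n.-1 * bool).

Inductive braid_rel (n : nat) : braid_word n -> braid_word n -> Prop :=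
| braid_refl u : braid_rel u u
| braid_sym u v : braid_rel u v -> braid_rel v u
| braid_trans u v t : braid_rel u v -> braid_rel v t -> braid_rel u t
| braid_cat u u' v v' :
    braid_rel u u' -> braid_rel v v' -> braid_rel (u ++ v) (u' ++ v')
| braid_cancel i b : braid_rel [:: (i, b); (i, ~~ b)] [::]
| braid_comm (i j : 'I_n.-1) : (i.+1 < j)%N ->
    braid_rel [:: (i, false); (j, false)] [:: (j, false); (i, false)]
| braid_yb (i j : 'I_n.-1) : j = i.+1 :> nat ->
    braid_rel [:: (i, false); (j, false); (i, false)]
              [:: (j, false); (i, false); (j, false)].

Section BraidGroup.
Variable n : nat.

Definition braid_relb (u v : braid_word n) : bool := `[< braid_rel u v >].

Lemma braid_relb_refl : reflexive braid_relb.
Proof. by move=> u; apply/asboolP; exact: braid_refl. Qed.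
Lemma braid_relb_sym : symmetric braid_relb.
Proof. by move=> u v; apply/asboolP/asboolP => /braid_sym. Qed.
Lemma braid_relb_trans : transitive braid_relb.
Proof.
by move=> v u t /asboolP uv /asboolP vt; apply/asboolP; exact: braid_trans uv vt.
Qed.

Definition braid_equiv := EquivRel braid_relb
  braid_relb_refl braid_relb_sym braid_relb_trans.

Definition braid_group := {eq_quot braid_equiv}.
HB.instance Definition _ := Choice.on braid_group.
HB.instance Definition _ := EqQuotient.on braid_group.

Lemma braid_piP (u v : braid_word n) :
  (\pi_braid_group u = \pi_braid_group v) <-> braid_rel u v.
Proof. by split=> [/eqmodP/asboolP|uv]; last by apply/eqmodP/asboolP. Qed.

Definition braid_gen (i : 'I_n.-1) : braid_group :=
  \pi_braid_group [:: (i, false)].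

Definition word_inv (u : braid_word n) : braid_word n :=
  rev [seq (x.1, ~~ x.2) | x <- u].

Definition braid_one : braid_group := \pi_braid_group [::].
Definition braid_mul (a b : braid_group) : braid_group :=
  \pi_braid_group (repr a ++ repr b).
Definition braid_inv (a : braid_group) : braid_group :=
  \pi_braid_group (word_inv (repr a)).

Lemma braid_mulE u v :
  braid_mul (\pi_braid_group u) (\pi_braid_group v) = \pi_braid_group (u ++ v).
Proof. by apply/braid_piP/braid_cat; apply/braid_piP; rewrite reprK. Qed.

Lemma word_invr u : braid_rel (u ++ word_inv u) [::].
Proof.
elim: u => [|[i b] u IH]; first exact: braid_refl.
rewrite /word_inv /= rev_cons -cats1 -cat_cons catA cats1 -cats1.
apply: (braid_trans _ (braid_cancel i b)).
rewrite -[(i, b) :: u]cat1s -[[:: (i, b); _]]cat1s -catA.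
rewrite -!catA; apply: braid_cat; first exact: braid_refl.
rewrite catA -[X in braid_rel _ X]cat0s; apply: braid_cat => //; exact: braid_refl.
Qed.

Lemma word_invK : involutive word_inv.
Proof.
move=> u; rewrite /word_inv map_rev revK -map_comp -[RHS]map_id.
by apply: eq_map => -[i b] /=; rewrite negbK.
Qed.

Lemma braid_mulA : associative braid_mul.
Proof.
elim/quotW=> a; elim/quotW=> b; elim/quotW=> c.
rewrite (braid_mulE b c) (braid_mulE a b) 2!braid_mulE catA; reflexivity.
Qed.
Lemma braid_mul1 : left_id braid_one braid_mul.
Proof. by elim/quotW=> a; rewrite braid_mulE. Qed.
Lemma braid_mulr1 : right_id braid_one braid_mul.
Proof. by elim/quotW=> a; rewrite braid_mulE cats0. Qed.
Lemma braid_mulVr : right_inverse braid_one braid_inv braid_mul.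
Proof.
move=> a; rewrite -{1}[a]reprK /braid_inv braid_mulE; apply/braid_piP.
exact: word_invr.
Qed.
Lemma braid_mulV : left_inverse braid_one braid_inv braid_mul.
Proof.
move=> a; rewrite -{2}[a]reprK /braid_inv braid_mulE; apply/braid_piP.
by rewrite -{2}[repr a]word_invK; exact: word_invr.
Qed.

HB.instance Definition _ := isGroup.Build braid_group
  braid_mulA braid_mul1 braid_mulr1 braid_mulV braid_mulVr.

End BraidGroup.

(* Main.v *)
From HB Require Import structures.
Require Import Defs.
From mathcomp Require Import all_boot all_order all_algebra all_fingroup.
From mathcomp Require Import generic_quotient reals complex boolp ring.

(** Write L for L(H, gamma), T for its n-th tensor power and T_e for the part
    of degree e.

    A morphism from the unit to T is determined by the image of 1, which is an
    arbitrary G-invariant vector of T_e.  On T_e the twisted action is an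
    honest action, because omega(g, h; e) = 1, and it is monomial for the basis
    of tensors of the chi's (chi_monomial_basis, pow_monomial_basis).  In
    characteristic 0 the invariants are the image of the averaging operator
    u |-> sum_g g |> u, hence they are spanned by the averages of the basis
    vectors.  Two basis vectors in one G-orbit have proportional averages.  If
    some g fixes the line of b but multiplies b by c <> 1, the average m
    satisfies m = c m and vanishes; if b is regular, the coefficient of b in
    its average is the order of the stabilizer, which is not 0.  Averages for
    different orbits have disjoint supports.  So the averages over the regular
    orbits span lines whose direct sum is Hom(1, T) (regular_orbit_lines), which
    is the dimension formula.

    The braid generators commute with the action of G and send each basis
    tensor to a nonzero multiple of another one (sigma_monomial).  Commuting
    with averaging, they send each of the lines above to another such line: the
    image of a nonzero average is a nonzero multiple of an average, and an
    average is nonzero only over a regular orbit.  That the generators define a representation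
    of the braid group is the content of sigma_comm and sigma_yang_baxter, and
    permuting lines passes from generators to the whole group
    (braid_permutes_lines).

    Every identity between morphisms out of iterated tensor products is checked
    on homogeneous pure tensors, where it becomes an identity between values of
    omega that follows from finitely many instances of the cocycle equation. *)

Set Implicit Arguments.
Unset Strict Implicit.
Unset Printing Implicit Defensive.

Import GRing.Theory.

Local Open Scope ring_scope.
Local Open Scope quotient_scope.

(** * Homogeneous generators *)

Section GradedGeneration.
Variables (F : fieldType) (gT : finGroupType) (w : cocycle3 F gT).
Implicit Types (V W X : zobj w) (g h k a b c : gT).

(** The degree is carried along with the generators, so that one notion serves
    both to compare linear maps and to recognize morphisms, and is stable under
    tensor products. *)
Definition graded_gen V (P : gT -> V -> Prop) : Prop := forall g,
  (forall v, P g v -> v \in zdeg V g) /\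
  (forall U : {vspace V}, (forall v, P g v -> v \in U) -> (zdeg V g <= U)%VS).

Definition homog V : gT -> V -> Prop := fun g v => v \in zdeg V g.

Definition tens_gen V W (P : gT -> V -> Prop) (Q : gT -> W -> Prop) :
    gT -> ztens V W -> Prop :=
  fun k t => exists g h v v', [/\ P g v, Q h v', k = (g * h)%g & t = tens v v'].

Lemma homog_gen V : graded_gen (@homog V).
Proof. by move=> g; split=> // U UP; apply/subvP. Qed.

Lemma tens_gen_gen V W P Q :
  @graded_gen V P -> @graded_gen W Q -> graded_gen (tens_gen P Q).
Proof.
move=> Pg Qg k; split=> [_ [g [h [v [v' [Pv Qv -> ->]]]]]|U UP].
  by apply: tensor_compP; [apply: (Pg g).1 | apply: (Qg h).1].
apply: tensor_comp_ind => h l v v' vh vl kE.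
have lr u : linear (fun x : V => tens x u : ztens V W).
  by move=> a x y; rewrite (tens_bilin _ _).1.
have rr u : linear (fun x : W => tens u x : ztens V W).
  by move=> a x y; rewrite (tens_bilin _ _).2.
have step y : Q l y -> tens v y \in U.
  move=> Qy.
  have := subvP ((Pg h).2 (linfun (fun x => tens x y : ztens V W) @^-1: U)%VS _) _ vh.
  rewrite -memv_preim linfun_linE //; apply=> x Px.
  by rewrite -memv_preim linfun_linE //; apply: UP; exists h, l, x, y.
have := subvP ((Qg l).2 (linfun (fun x => tens v x : ztens V W) @^-1: U)%VS _) _ vl.
rewrite -memv_preim linfun_linE //; apply=> x Px.
by rewrite -memv_preim linfun_linE //; apply: step.
Qed.

Lemma gen_full V P (U : {vspace V}) : graded_gen P ->
  (forall g v, P g v -> v \in U) -> (fullv <= U)%VS.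
Proof.
move=> Pg UP; rewrite (gcompP (zdeg V)).1; apply/subv_sumP=> g _.
by apply: (Pg g).2 => v; apply: UP.
Qed.

Lemma gen_ext V (U : vectType F) P (f f' : 'Hom(V, U)) : graded_gen P ->
  (forall g v, P g v -> f v = f' v) -> f = f'.
Proof.
move=> Pg E; apply/lfunP=> v; apply/eqP; rewrite -subr_eq0.
have: v \in lker (f - f').
  apply: subvP (memvf v); apply: (gen_full Pg) => g u Pu.
  by rewrite memv_ker !lfunE /= lfunE /= (E _ _ Pu) subrr.
by rewrite memv_ker !lfunE /= lfunE.
Qed.

(** Equivariance needs the generators only, but for preservation of the grading
    they have to generate each degree separately. *)
Lemma gen_zmor V W P (f : 'Hom(V, W)) : graded_gen P ->
  (forall g v, P g v -> f v \in zdeg W g) ->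
  (forall g k v, P g v -> f (zact V k v) = zact W k (f v)) -> is_zmor f.
Proof.
move=> Pg fd fa; split=> [g v vg|k v].
  have := subvP ((Pg g).2 (f @^-1: zdeg W g)%VS _) v vg; rewrite -memv_preim.
  by apply=> u Pu; rewrite -memv_preim; apply: fd.
suff : (f \o zact V k = zact W k \o f)%VF by move/lfunP/(_ v); rewrite !lfunE.
by apply: (gen_ext Pg) => g u Pu; rewrite !lfunE /=; apply: fa Pu.
Qed.

Lemma zmor_id V : is_zmor (\1%VF : 'Hom(V, V)).
Proof. by split=> [g v|k v]; rewrite !lfunE. Qed.

Lemma zmor_comp V W X (f : 'Hom(W, X)) (f' : 'Hom(V, W)) :
  is_zmor f -> is_zmor f' -> is_zmor (f \o f')%VF.
Proof.
move=> [fd fa] [gd ga]; split=> [g v vg|k v]; rewrite !lfunE /=.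
  exact/fd/gd.
by rewrite ga fa.
Qed.

Let bl := tens_bilin.

Lemma zmor_tens V V' W W' (f : 'Hom(V, V')) (f' : 'Hom(W, W')) :
  is_zmor f -> is_zmor f' ->
  is_zmor (tens_map f f' : 'Hom(ztens V W, ztens V' W')).
Proof.
move=> [fd fa] [gd ga].
apply: (gen_zmor (tens_gen_gen (@homog_gen V) (@homog_gen W))).
  move=> ? ? [g [h [v [v' [vg vh -> ->]]]]].
  by rewrite tens_mapE; apply: tensor_compP; [apply: fd|apply: gd].
move=> ? k ? [g [h [v [v' [vg vh _ ->]]]]].
rewrite /= (tensor_actE _ vg vh) tens_mapE (tensor_actE _ (fd _ _ vg) (gd _ _ vh)).
by rewrite linearZ /= tens_mapE fa ga.
Qed.

(** The twisted action of g is invertible only up to a scalar depending on the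
    degree. *)
Lemma zactK V g h v : v \in zdeg V h ->
  exists2 c, c != 0 & zact V g (zact V g^-1%g v) = c *: v.
Proof.
move=> vh; have := zactM g g^-1%g vh; rewrite mulgV zact1 => E.
exists (omega_act w g g^-1%g h)^-1; first by rewrite invr_eq0 omega_act_neq0.
by rewrite {2}E scalerA mulVf ?scale1r // omega_act_neq0.
Qed.

Lemma onto_lker0 (U : vectType F) (f : 'End(U)) :
  (fullv <= limg f)%VS -> lker f == 0%VS.
Proof.
move=> ff; rewrite -dimv_eq0; have := limg_ker_dim f fullv.
have -> : limg f = fullv by apply/eqP; rewrite eqEsubv subvf.
by rewrite capfv -[X in _ = X]add0n => /addIn ->.
Qed.

Lemma zbraidE V W g (v : V) (v' : W) : v \in zdeg V g ->
  zbraid V W (tens v v') = tens (zact W g v') v.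
Proof.
move=> vg; rewrite /zbraid tens_liftE.
  rewrite (bigD1 g) //= big1 ?addr0 ?(hpartE _ vg) ?eqxx // => h hg.
  by rewrite (hpartE _ vg) (negbTE hg) (bilin0r (bl _ _)).
split=> [u a x y|u a x y]; rewrite scaler_sumr -big_split /=; apply: eq_bigr => h _.
  by rewrite linearP (bl _ _).2.
by rewrite linearP (bl _ _).1.
Qed.

Lemma zassocE V W X g h k (v : V) (v' : W) (z : X) :
  v \in zdeg V g -> v' \in zdeg W h -> z \in zdeg X k ->
  zassoc V W X (tens (tens v v') z) = w g h k *: tens v (tens v' z : ztens W X).
Proof.
move=> vg vh zk; rewrite /zassoc.
have bi (x : X) : bilin (fun (v : V) (v' : W) => \sum_g \sum_h \sum_k
      w g h k *: (tens (hpart V g v) (tens (hpart W h v') (hpart X k x) : ztens W X)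
                  : ztens V (ztens W X))).
  by split=> [u a y y'|u a y y']; rewrite scaler_sumr -big_split /=;
    apply: eq_bigr => g' _; rewrite scaler_sumr -big_split /=;
    apply: eq_bigr => h' _; rewrite scaler_sumr -big_split /=;
    apply: eq_bigr => k' _; rewrite linearP ?(bl _ _).1 ?(bl _ _).2 scalerDr !scalerA
      [a * _]mulrC.
rewrite tens_liftE.
  rewrite tens_liftE //.
  (* Only the term indexed by the degrees of the three factors survives. *)
  rewrite (bigD1 g) //= [X in _ + X]big1 ?addr0 => [|g' g'g]; last first.
    rewrite big1 // => h' _; rewrite big1 // => k' _.
    by rewrite (hpartE _ vg) (negbTE g'g) (bilin0l (bl _ _)) scaler0.
  rewrite (bigD1 h) //= [X in _ + X]big1 ?addr0 => [|h' h'h]; last first.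
    rewrite big1 // => k' _.
    by rewrite (hpartE _ vh) (negbTE h'h) (bilin0l (bl _ _)) (bilin0r (bl _ _)) scaler0.
  rewrite (bigD1 k) //= [X in _ + X]big1 ?addr0 => [|k' k'k]; last first.
    by rewrite (hpartE _ zk) (negbTE k'k) (bilin0r (bl _ _)) (bilin0r (bl _ _)) scaler0.
  by rewrite (hpartE _ vg) (hpartE _ vh) (hpartE _ zk) !eqxx.
(* Remaining goal: the inner map is also linear in the third factor. *)
split=> [u a y y'|u a y y']; first by rewrite linearP.
rewrite !tens_liftK // scaler_sumr -big_split /=.
apply: eq_bigr => i _; rewrite scaler_sumr -big_split /=; apply: eq_bigr => j _.
rewrite scalerA [a * _]mulrC -scalerA -scalerDr; congr (_ *: _).
rewrite scaler_sumr -big_split /=;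
    apply: eq_bigr => g' _; rewrite scaler_sumr -big_split /=;
    apply: eq_bigr => h' _; rewrite scaler_sumr -big_split /=;
    apply: eq_bigr => k' _.
by rewrite linearP !(bl _ _).2 scalerDr !scalerA [a * _]mulrC.
Qed.

End GradedGeneration.

(** * Consequences of the cocycle equation *)

Section CocycleIdentities.
Variables (F : fieldType) (gT : finGroupType) (w : cocycle3 F gT).
Implicit Types (g h k a b c d : gT).

Let nz := omega_neq0 w.

Lemma cocycle_solve a b c d : w (a * b)%g c d =
  w a b c * w a (b * c)%g d * w b c d / w a b (c * d)%g.
Proof. by rewrite -omega_cocycle mulfK. Qed.

(** This scalar identity says that the associator commutes with the action of
    h: it uses the cocycle equation for the four ways of inserting h into the
    triple g, a, b. *)
Lemma assoc_equivariant h g a b :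
  omega_tens w h (g * a)%g b * omega_tens w h g a
    * w (lconj h g) (lconj h a) (lconj h b) =
  w g a b * omega_tens w h g (a * b)%g * omega_tens w h a b.
Proof.
rewrite /omega_tens (lconjMr h a b) (lconjMr h g a).
set g' := lconj h g; set a' := lconj h a; set b' := lconj h b.
have E1 := cocycle_solve g' a' b' h; have E2 := cocycle_solve g' a' h b.
have E3 := cocycle_solve g' h a b; have E4 := cocycle_solve h g a b.
rewrite (lconjE h b) in E1; rewrite (lconjE h a) in E2.
rewrite (lconjE h g) in E3.
rewrite E1 E2; have {E3}E4 := etrans (esym E4) E3.
have -> : w g a b = w g' h a * w g' (h * a)%g b * w h a b / w g' h (a * b)%g
   * w h g (a * b)%g / (w h g a * w h (g * a)%g b).
  (* The instances at (h, g, a, b) and (g', h, a, b) share their left side. *)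
  have := congr1 (fun x => x * w h g (a * b)%g / (w h g a * w h (g * a)%g b)) E4.
  by rewrite /= => <-; field; rewrite !nz.
by field; rewrite !nz.
Qed.

(** Equivariance of the braiding on scalars; it holds by the definitions of the
    two derived cochains alone. *)
Lemma braid_equivariant h a b :
  omega_tens w h a b * omega_act w h a b =
  omega_tens w h (lconj a b) a * omega_act w (lconj h a) h b.
Proof.
rewrite /omega_tens /omega_act !lconjE !lconjM.
by field; rewrite !nz.
Qed.

(** The scalar by which a braid generator acts on homogeneous factors of degrees
    a and b when the factors to their left have total degree d. *)
Definition sigma_coef d a b : F := w d a b / w d (lconj a b) a.

Lemma sigma_coef_neq0 d a b : sigma_coef d a b != 0.
Proof. by rewrite mulf_neq0 ?invr_eq0. Qed.

(** An empty left part contributes no scalar; with this the first generator,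
    which is a bare braiding, obeys the same formulas as the others. *)
Lemma sigma_coef1 a b : sigma_coef 1%g a b = 1.
Proof. by rewrite /sigma_coef !omega1l divr1. Qed.

(** The scalars on the two sides of the Yang-Baxter equation on degrees a, b, c
    after a prefix of degree d.  The factors omega_act compare the two ways in
    which the third vector is moved by a and b.  All terms cancel once the
    cocycle equation is applied to d followed by each of the triples of degrees
    that occur on the way. *)
Lemma yang_baxter_coef d a b c (b' := lconj a b) (c' := lconj a c)
    (c'' := lconj b c) (x := lconj a c'') :
  sigma_coef d a b * sigma_coef (d * b')%g a c * sigma_coef d b' c'
    * omega_act w a b c =
  sigma_coef (d * a)%g b c * sigma_coef d a c'' * sigma_coef (d * x)%g a b
    * omega_act w b' a c.
Proof.
have xE : lconj b' c' = x by rewrite /b' /c' /x /c'' -!lconjM lconjE.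
have xE2 : lconj (b' * a)%g c = x by rewrite /b' lconjE lconjM.
have xE3 : lconj (a * b)%g c = x by rewrite lconjM.
rewrite /sigma_coef /omega_act -/b' -/c' -/c'' -/x xE xE2 xE3.
have E1 := cocycle_solve d a b c; have E2 := cocycle_solve d b' a c.
have E3 := cocycle_solve d b' c' a; have E4 := cocycle_solve d x b' a.
have E5 := cocycle_solve d x a b; have E6 := cocycle_solve d a c'' b.
have P1 : (b' * a)%g = (a * b)%g by exact: lconjE.
have P2 : (c' * a)%g = (a * c)%g by exact: lconjE.
have P3 : (c'' * b)%g = (b * c)%g by exact: lconjE.
have P4 : (x * a)%g = (a * c'')%g by exact: lconjE.
have P5 : (b' * c')%g = (x * b')%g by rewrite -xE lconjE.
rewrite E1 E2 E3 E4 E5 E6 P1 P2 P3 P4 P5; field; by rewrite !nz.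
Qed.

End CocycleIdentities.

(** * Associator, braiding and the Yang-Baxter equation *)

Section Braiding.
Variables (F : fieldType) (gT : finGroupType) (w : cocycle3 F gT).
Implicit Types (V W X T : zobj w) (g h k a b c : gT).

Let bl := tens_bilin.
Notation HG := (homog_gen (w := w)).

Lemma ztens_deg V W g h (v : V) (v' : W) : v \in zdeg V g -> v' \in zdeg W h ->
  (tens v v' : ztens V W) \in zdeg (ztens V W) (g * h)%g.
Proof. exact: tensor_compP. Qed.

Lemma ztens_actE V W h g l (v : V) (v' : W) :
  v \in zdeg V g -> v' \in zdeg W l ->
  zact (ztens V W) h (tens v v') =
    omega_tens w h g l *: tens (zact V h v) (zact W h v').
Proof. exact: tensor_actE. Qed.

Lemma zbraid_zmor V W : is_zmor (zbraid V W).
Proof.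
apply: (gen_zmor (tens_gen_gen (HG V) (HG W))).
  move=> ? ? [g [h [v [v' [vg vh -> ->]]]]].
  by rewrite (zbraidE _ vg) -(lconjE g h); apply: ztens_deg => //; apply: zact_deg.
move=> ? k ? [g [h [v [v' [vg vh _ ->]]]]].
rewrite (ztens_actE _ vg vh) linearZ /= (zbraidE _ vg).
rewrite (ztens_actE _ (zact_deg _ vh) vg) (zbraidE _ (zact_deg _ vg)).
have E1 := zactM (lconj k g) k vh; have E2 := zactM k g vh.
rewrite lconjE in E1; have E := etrans (esym E2) E1.
have -> : zact W k (zact W g v') = (omega_act w (lconj k g) k h / omega_act w k g h)
    *: zact W (lconj k g) (zact W k v').
  by rewrite mulrC -scalerA -E scalerA mulVf ?scale1r // omega_act_neq0.
rewrite (bilinZl (bl _ _)) !scalerA mulrA -braid_equivariant mulfK //.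
exact: omega_act_neq0.
Qed.

Lemma zassoc_zmor V W X : is_zmor (zassoc V W X).
Proof.
apply: (gen_zmor (tens_gen_gen (tens_gen_gen (HG V) (HG W)) (HG X))).
  move=> ? ? [? [k [? [z [[g [h [v [v' [vg vh -> ->]]]]] zk -> ->]]]]].
  rewrite (zassocE vg vh zk) memvZ // -mulgA.
  by apply: ztens_deg => //; apply: ztens_deg.
move=> ? l ? [? [k [? [z [[g [h [v [v' [vg vh -> ->]]]]] zk _ ->]]]]].
rewrite (ztens_actE _ (ztens_deg vg vh) zk) (ztens_actE _ vg vh).
rewrite (zassocE vg vh zk) !linearZ /= (ztens_actE _ vg (ztens_deg vh zk)).
rewrite (ztens_actE _ vh zk) (bilinZl (bl _ _)) (bilinZr (bl _ _)) !linearZ /=.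
rewrite (zassocE (zact_deg _ vg) (zact_deg _ vh) (zact_deg _ zk)) !scalerA.
rewrite [omega_tens w l g h * omega_tens w l _ _]mulrC assoc_equivariant.
by rewrite -mulrA mulrC.
Qed.

Lemma dim_ztens V W : (\dim {:ztens V W} = \dim {:V} * \dim {:W})%N.
Proof. by rewrite dimvf. Qed.

(** On homogeneous tensors the associator is a nonzero multiple of regrouping,
    so it is onto; injectivity then follows by counting dimensions. *)
Lemma zassoc_onto V W X : limg (zassoc V W X) = fullv.
Proof.
have Q := tens_gen_gen (HG V) (tens_gen_gen (HG W) (HG X)).
apply/eqP; rewrite eqEsubv subvf /=; apply: (gen_full Q).
move=> ? ? [g [? [v [? [vg [h [k [v' [z [vh zk -> ->]]]]] _ ->]]]]].
have -> : tens v (tens v' z : ztens W X) =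
   zassoc V W X ((w g h k)^-1 *: tens (tens v v' : ztens V W) z).
  rewrite linearZ /=.
  by rewrite (zassocE vg vh zk) scalerA mulVf ?scale1r ?omega_neq0.
by rewrite memv_img ?memvf.
Qed.

Lemma zassoc_inj V W X : lker (zassoc V W X) == 0%VS.
Proof.
have := limg_ker_dim (zassoc V W X) fullv.
rewrite zassoc_onto capfv !dim_ztens mulnA -[X in _ = X]add0n => /eqP.
by rewrite eqn_add2r dimv_eq0.
Qed.

(** The braid generator on the last two of three factors, for an arbitrary left
    factor T. *)
Definition braid_step T V : 'End(ztens (ztens T V) V) :=
  ((zassoc T V V)^-1
      \o (tens_map \1 (zbraid V V) : 'End(ztens T (ztens V V)))
      \o zassoc T V V)%VF.

Lemma braid_stepE T V g a b (t : T) (v v' : V) :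
  t \in zdeg T g -> v \in zdeg V a -> v' \in zdeg V b ->
  braid_step T V (tens (tens t v : ztens T V) v') =
    sigma_coef w g a b *: tens (tens t (zact V a v') : ztens T V) v.
Proof.
move=> tg va vb; rewrite !comp_lfunE (zassocE tg va vb) linearZ /= tens_mapE.
rewrite id_lfunE (zbraidE _ va) linearZ /=.
have : zassoc T V V (tens (tens t (zact V a v') : ztens T V) v) =
    w g (lconj a b) a *: tens t (tens (zact V a v') v : ztens V V).
  by rewrite (zassocE tg (zact_deg _ vb) va).
move/(congr1 (fun u => (w g (lconj a b) a)^-1 *: (zassoc T V V)^-1%VF u)).
rewrite lker0_lfunK ?zassoc_inj // linearZ /= scalerA mulVf ?omega_neq0 // scale1r.
by move=> <-; rewrite scalerA.
Qed.

Let Q3 T V := tens_gen_gen (tens_gen_gen (HG T) (HG V)) (HG V).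

(** The degree is read off the formula.  For equivariance the three factors of
    the composite are treated separately; the inverse associator commutes with
    the action because the associator does and is bijective. *)
Lemma braid_step_zmor T V : is_zmor (braid_step T V).
Proof.
apply: (gen_zmor (Q3 T V)).
  move=> ? ? [? [b [? [v' [[g [a [t [v [tg va -> ->]]]]] vb -> ->]]]]].
  rewrite (braid_stepE tg va vb) memvZ // -mulgA -(lconjE a b) mulgA.
  by apply: ztens_deg => //; apply: ztens_deg => //; apply: zact_deg.
have fz : is_zmor (tens_map \1 (zbraid V V) : 'End(ztens T (ztens V V))).
  by apply: zmor_tens (zmor_id _) (zbraid_zmor _ _).
have inj := zassoc_inj T V V.
move=> _ k u _; rewrite !comp_lfunE (zassoc_zmor _ _ _).2 fz.2.
set y := tens_map _ _ _.
have /memv_imgP[z _ ->] : y \in limg (zassoc T V V) by rewrite zassoc_onto memvf.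
by rewrite -(zassoc_zmor _ _ _).2 !lker0_lfunK.
Qed.

(** Onto, hence injective: a preimage is found by acting with the inverse of a
    degree, which works up to a nonzero scalar. *)
Lemma zbraid_inj V : lker (zbraid V V) == 0%VS.
Proof.
apply: onto_lker0; apply: (gen_full (tens_gen_gen (HG V) (HG V))).
move=> ? ? [a [b [v [u [va ub _ ->]]]]].
have [c c0 cE] := zactK b va.
have -> : tens v u = zbraid V V (c^-1 *: tens u (zact V b^-1%g v)).
  by rewrite linearZ /= (zbraidE _ ub) cE (bilinZl (bl _ _)) scalerA mulVf ?scale1r.
by rewrite memv_img ?memvf.
Qed.

Lemma tens_map_inj V W (f : 'End(V)) (f' : 'End(W)) :
  lker f == 0%VS -> lker f' == 0%VS ->
  lker (tens_map f f' : 'End(ztens V W)) == 0%VS.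
Proof.
move=> f0 g0; apply: onto_lker0; apply: (gen_full (tens_gen_gen (HG V) (HG W))).
move=> ? ? [a [b [v [u [_ _ _ ->]]]]].
rewrite -[v](lker0_lfunVK f0) -[u](lker0_lfunVK g0) -tens_mapE.
by rewrite memv_img ?memvf.
Qed.

Lemma braid_step_inj T V : lker (braid_step T V) == 0%VS.
Proof.
apply: onto_lker0; apply: (gen_full (Q3 T V)).
move=> ? ? [? [b [? [u [[g [a [t [v [tg va _ ->]]]]] ub _ ->]]]]].
have [c c0 cE] := zactK b va.
have := braid_stepE tg ub (zact_deg b^-1%g va).
set s := sigma_coef _ _ _ _ => sE; have s0 : s != 0 by exact: sigma_coef_neq0.
have -> : tens (tens t v : ztens T V) u = braid_step T V ((s * c)^-1 *:
    tens (tens t u : ztens T V) (zact V b^-1%g v)).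
  rewrite linearZ /= sE cE (bilinZr (bl _ _)) (bilinZl (bl _ _)) !scalerA -mulrA.
  rewrite mulVf ?scale1r //.
  exact: mulf_neq0.
by rewrite memv_img ?memvf.
Qed.

(** A morphism f of the left factor preserves degrees, and the braid step sees
    the left factor only through its degree. *)
Lemma braid_step_comm T V (f : 'End(T)) : is_zmor f ->
  let f2 := tens_map (tens_map f \1 : 'End(ztens T V)) \1 :
     'End(ztens (ztens T V) V) in
  (braid_step T V \o f2 = f2 \o braid_step T V)%VF.
Proof.
move=> fz f2; apply: (gen_ext (Q3 T V)).
move=> ? ? [? [b [? [u [[g [a [t [v [tg va _ ->]]]]] ub _ ->]]]]].
rewrite [LHS]comp_lfunE [RHS]comp_lfunE !tens_mapE !id_lfunE.
rewrite [LHS](braid_stepE (fz.1 _ _ tg) va ub) (braid_stepE tg va ub).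
by rewrite linearZ /= !tens_mapE !id_lfunE.
Qed.

(** Both sides are the action of ab = (aba^-1)a; this is the relation that makes
    conjugation a solution of the braid relation. *)
Lemma zact_braid V a b c (v : V) : v \in zdeg V c ->
  omega_act w a b c *: zact V a (zact V b v) =
  omega_act w (lconj a b) a c *: zact V (lconj a b) (zact V a v).
Proof. by move=> vc; rewrite -!(zactM _ _ vc) lconjE. Qed.

Lemma comp3_lfunE (U V W X : vectType F) (f : 'Hom(W, X)) (f' : 'Hom(V, W))
  (f'' : 'Hom(U, V)) u : (f \o (f' \o f''))%VF u = f (f' (f'' u)).
Proof. by rewrite !comp_lfunE. Qed.

(** The Yang-Baxter equation for the first two generators, where the left part
    is empty and the first generator is the braiding itself. *)
Lemma yang_baxter_zbraid V :
  let s1 := tens_map (zbraid V V) \1 : 'End(ztens (ztens V V) V) in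
  let s2 := braid_step V V in
  (s1 \o (s2 \o s1) = s2 \o (s1 \o s2))%VF.
Proof.
move=> s1 s2; apply: (gen_ext (Q3 V V)).
move=> ? ? [? [c [? [z [[a [b [x [y [xa yb _ ->]]]]] zc _ ->]]]]].
have ayb := zact_deg a yb; have azc := zact_deg a zc; have bzc := zact_deg b zc.
rewrite [LHS]comp3_lfunE [RHS]comp3_lfunE tens_mapE id_lfunE (zbraidE _ xa).
rewrite (braid_stepE ayb xa zc).
rewrite linearZ /= tens_mapE id_lfunE (zbraidE _ ayb).
rewrite (braid_stepE xa yb zc) !linearZ /= tens_mapE id_lfunE (zbraidE _ xa).
rewrite (braid_stepE (zact_deg a bzc) xa yb) scalerA.
have := yang_baxter_coef w 1%g a b c; cbv zeta.
rewrite !mul1g !sigma_coef1 !mul1r !mulr1 => E.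
have nz := omega_act_neq0 w.
have -> : zact V a (zact V b z) = (omega_act w (lconj a b) a c / omega_act w a b c)
    *: zact V (lconj a b) (zact V a z).
  by rewrite mulrC -scalerA -(zact_braid a b zc) scalerA mulVf ?scale1r ?nz.
rewrite !(bilinZl (bl _ _)) scalerA mulrA -E mulfK //; exact: nz.
Qed.

Lemma yang_baxter T V :
  let s1 := tens_map (braid_step T V) \1 : 'End(ztens (ztens (ztens T V) V) V) in
  let s2 := braid_step (ztens T V) V in
  (s1 \o (s2 \o s1) = s2 \o (s1 \o s2))%VF.
Proof.
move=> s1 s2; apply: (gen_ext (tens_gen_gen (Q3 T V) (HG V))).
move=> ? ? [? [c [? [z [[? [b [? [y [txd yb _ ->]]]]] zc _ ->]]]]].
case: txd => d [a [t [x [td xa _ ->]]]].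
have ayb := zact_deg a yb; have azc := zact_deg a zc; have bzc := zact_deg b zc.
rewrite [LHS]comp3_lfunE [RHS]comp3_lfunE tens_mapE id_lfunE (braid_stepE td xa yb).
rewrite (bilinZl (bl _ _)) [s2 (_ *: _)]linearZ /=.
rewrite (braid_stepE (ztens_deg td ayb) xa zc) !linearZ /= tens_mapE id_lfunE.
rewrite (braid_stepE td ayb azc) (bilinZl (bl _ _)).
rewrite (braid_stepE (ztens_deg td xa) yb zc) !linearZ /= tens_mapE id_lfunE.
rewrite (braid_stepE td xa bzc) (bilinZl (bl _ _)) [s2 (_ *: _)]linearZ /=.
rewrite [s2 _](braid_stepE (ztens_deg td (zact_deg a bzc)) xa yb) !scalerA.
have := yang_baxter_coef w d a b c; cbv zeta => E.
have nz := omega_act_neq0 w.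
have -> : zact V a (zact V b z) = (omega_act w (lconj a b) a c / omega_act w a b c)
    *: zact V (lconj a b) (zact V a z).
  by rewrite mulrC -scalerA -(zact_braid a b zc) scalerA mulVf ?scale1r ?nz.
rewrite !(bilinZr (bl _ _)) !(bilinZl (bl _ _)) scalerA.
by rewrite [X in _ = X *: _]mulrA -E mulfK // [X in X *: _ = _]mulrC mulrA.
Qed.

End Braiding.

(** * The braid generators on tensor powers *)

Section BraidAction.
Variables (F : fieldType) (gT : finGroupType) (w : cocycle3 F gT) (V : zobj w).

Lemma sigmaS p i : sigma V p.+2 i =
  if i == p.+1 then sigma_last V p else tens_map (sigma V p.+1 i) \1%VF.
Proof. by []. Qed.

Lemma sigma_last_zmor p : is_zmor (sigma_last V p).
Proof. by case: p => [|p]; [exact: zbraid_zmor | exact: braid_step_zmor]. Qed.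

Lemma sigma_zmor n i : is_zmor (sigma V n.+1 i).
Proof.
elim: n => [|p IH]; first exact: (zmor_id V).
rewrite sigmaS; case: eqP => _; first exact: sigma_last_zmor.
exact: (zmor_tens IH (zmor_id V)).
Qed.

Lemma lker_id (U : vectType F) : lker (\1%VF : 'End(U)) == 0%VS.
Proof. by apply/lker0P=> u v; rewrite !id_lfunE. Qed.

Lemma sigma_inj n i : lker (sigma V n.+1 i) == 0%VS.
Proof.
elim: n => [|p IH]; first exact: lker_id.
rewrite sigmaS; case: (i =P p.+1) => _.
  by case: p {IH} => [|p]; [exact: zbraid_inj | exact: braid_step_inj].
exact: (tens_map_inj IH (lker_id V)).
Qed.

Lemma tens_map_comp1 (W : zobj w) (f f' : 'End(W)) :
  (tens_map f \1 \o tens_map f' \1 : 'End(ztens W V))%VF =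
    tens_map (f \o f')%VF \1%VF.
Proof.
by apply: tens_ext => u v; rewrite comp_lfunE !tens_mapE comp_lfunE !id_lfunE.
Qed.

(** By induction the larger index may be taken to be the last one; the smaller
    one then acts on the left factor of the last braid step. *)
Lemma sigma_comm n i j : (i.+1 < j <= n)%N ->
  (sigma V n.+1 i \o sigma V n.+1 j = sigma V n.+1 j \o sigma V n.+1 i)%VF.
Proof.
elim: n => [|p IH] /andP[ij jn]; first by rewrite leqNgt (leq_trans _ ij) in jn.
rewrite !sigmaS (_ : i == p.+1 = false); last first.
  by apply/negbTE; rewrite neq_ltn (leq_trans _ jn) // ltnW.
case: eqP => [jE|/eqP jp]; last first.
  by rewrite !tens_map_comp1 IH // ij -ltnS ltn_neqAle jp.
case: p {IH jn} jE => [|q] jE; first by rewrite jE in ij.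
rewrite sigmaS (_ : i == q.+1 = false); last first.
  by apply/negbTE; rewrite neq_ltn -ltnS -jE ij.
exact/esym/braid_step_comm/sigma_zmor.
Qed.

(** By induction the larger index may be taken to be the last one, which leaves
    the Yang-Baxter equation on the last three factors. *)
Lemma sigma_yang_baxter n i : (0 < i < n)%N ->
  let s := sigma V n.+1 in
  (s i \o (s i.+1 \o s i) = s i.+1 \o (s i \o s i.+1))%VF.
Proof.
elim: n => [|p IH] /andP[i0 ip] s; first by [].
rewrite /s !sigmaS (_ : i == p.+1 = false); last first.
  by apply/negbTE; rewrite neq_ltn ip.
rewrite eqSS; case: eqP => [iE|/eqP np]; last first.
  rewrite !tens_map_comp1 IH // i0 -ltnS ltn_neqAle ip andbT.
  by [].
subst i; case: p i0 {s IH ip} => // q _.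
rewrite sigmaS eqxx; case: q => [|q]; first exact: yang_baxter_zbraid.
exact: yang_baxter.
Qed.

End BraidAction.

(** * Monomial bases of tensor powers *)

Section TensorPowerBasis.
Variables (F : fieldType) (gT : finGroupType) (w : cocycle3 F gT).

Let bl := tens_bilin.

(** A homogeneous basis of V indexed by D whose lines are permuted by G.  The
    basis property is split into generation degree by degree and existence of
    dual functionals, since both pass to tensor powers without counting
    dimensions. *)
Record monomial_basis (V : zobj w) (I : finType) (D : {set I}) (b : I -> V)
    (deg : I -> gT) (act : gT -> I -> I) : Prop := MonomialBasis {
  mb_gen : graded_gen (fun g v => exists i, [/\ i \in D, deg i = g & v = b i]);
  mb_dual : forall i, i \in D -> exists c : 'Hom(V, F^o),
    forall j, j \in D -> c (b j) = (i == j)%:R;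
  mb_act : forall g i, i \in D -> act g i \in D /\
    exists2 c, c != 0 & zact V g (b i) = c *: b (act g i)
}.

Lemma mb_deg V I D b deg act i : @monomial_basis V I D b deg act ->
  i \in D -> b i \in zdeg V (deg i).
Proof. by case=> bg _ _ iD; apply: (bg _).1; exists i. Qed.

Variable V : zobj w.

Lemma tprodS n (v : 'I_n.+2 -> V) :
  tprod v = tens (tprod (fun i : 'I_n.+1 => v (lift ord_max i))) (v ord_max)
    :> ztens (tpow V n.+1) V.
Proof.
have <- : (fun i : 'I_n.+1 => v (widen_ord (leqnSn _) i)) = fun i => v (lift ord_max i).
  by apply: funext => i; congr v; apply: val_inj; rewrite /= /bump leqNgt ltn_ord.
by [].
Qed.

Lemma big_ord_lift_max (R : Type) (idx : R) (op : Monoid.law idx) n (d : 'I_n.+1 -> R) :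
  \big[op/idx]_i d i = op (\big[op/idx]_(i < n) d (lift ord_max i)) (d ord_max).
Proof.
rewrite big_ord_recr /=; congr (op _ _); apply: eq_bigr => i _; congr d.
by apply: val_inj; rewrite /= /bump leqNgt ltn_ord.
Qed.

Lemma tprod_scale n (v v' : 'I_n.+1 -> V) (c : 'I_n.+1 -> F) :
  (forall i, v i = c i *: v' i) -> tprod v = (\prod_i c i) *: tprod v'.
Proof.
elim: n v v' c => [|n IH] v v' c E; first by rewrite big_ord1 [LHS]E.
rewrite !tprodS E (IH _ _ _ (fun i => E (lift ord_max i))).
rewrite (bilinZl (bl _ _)) (bilinZr (bl _ _)) scalerA.
by rewrite [in RHS]big_ord_lift_max.
Qed.

Lemma tprod_deg n (v : 'I_n.+1 -> V) (d : 'I_n.+1 -> gT) :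
  (forall i, v i \in zdeg V (d i)) ->
  tprod v \in zdeg (tpow V n.+1) (\prod_i d i)%g.
Proof.
elim: n v d => [|n IH] v d E; first by rewrite big_ord1; exact: E.
rewrite tprodS big_ord_lift_max; apply: ztens_deg; last exact: E.
exact: IH.
Qed.

Lemma tprod_act n g (v : 'I_n.+1 -> V) (d : 'I_n.+1 -> gT) :
  (forall i, v i \in zdeg V (d i)) ->
  exists2 c, c != 0 &
    zact (tpow V n.+1) g (tprod v) = c *: tprod (fun i => zact V g (v i)).
Proof.
elim: n v d => [|n IH] v d E.
  by exists 1; rewrite ?oner_eq0 ?scale1r.
have E' i := E (lift ord_max i).
have [c c0 cE] := IH _ _ E'.
rewrite !tprodS (ztens_actE _ (tprod_deg E') (E ord_max)) cE (bilinZl (bl _ _)) scalerA.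
by eexists; last by []; rewrite mulf_neq0 // omega_tens_neq0.
Qed.

(** Functionals on the factors multiply to a functional on the tensor power;
    this produces the dual basis of a basis of tensors. *)
Lemma tprod_dual n (c : 'I_n.+1 -> 'Hom(V, F^o)) :
  exists C : 'Hom(tpow V n.+1, F^o), forall v, C (tprod v) = \prod_i c i (v i).
Proof.
elim: n c => [|n IH] c; first by exists (c ord0) => v; rewrite big_ord1.
have [C CE] := IH (fun i => c (lift ord_max i)).
exists (tens_lift (fun u v => C u * c ord_max v : F^o)) => v.
rewrite tprodS tens_liftE; last first.
  split=> [u a x y|u a x y]; rewrite linearP /=; rewrite /GRing.scale /=; ring.
by rewrite CE [RHS]big_ord_lift_max.
Qed.

Section Power.
Variables (I : finType) (D : {set I}) (b : I -> V) (deg : I -> gT).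
Variables (act : gT -> I -> I).
Hypothesis bV : monomial_basis D b deg act.

Definition pow_dom n : {set {ffun 'I_n -> I}} :=
  [set t : {ffun 'I_n -> I} | [forall i, t i \in D]].
Definition pow_basis n (t : {ffun 'I_n -> I}) : tpow V n := tprod (fun i => b (t i)).
Definition pow_deg n (t : {ffun 'I_n -> I}) : gT := (\prod_i deg (t i))%g.
Definition pow_act n g (t : {ffun 'I_n -> I}) : {ffun 'I_n -> I} :=
  [ffun i => act g (t i)].

Lemma pow_domP n (t : {ffun 'I_n -> I}) :
  reflect (forall i, t i \in D) (t \in pow_dom n).
Proof. by rewrite inE; apply: forallP. Qed.

(** Appending one entry mirrors the left parenthesization of tensor powers, so
    inductions peel off the last tensor factor. *)
Definition fsnoc n (t : {ffun 'I_n -> I}) (o : I) : {ffun 'I_n.+1 -> I} :=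
  [ffun i => if unlift ord_max i is Some j then t j else o].

Lemma fsnoc_lift n (t : {ffun 'I_n -> I}) o i : fsnoc t o (lift ord_max i) = t i.
Proof. by rewrite ffunE liftK. Qed.
Lemma fsnoc_max n (t : {ffun 'I_n -> I}) o : fsnoc t o ord_max = o.
Proof. by rewrite ffunE unlift_none. Qed.

Lemma fsnoc_dom n t o : t \in pow_dom n -> o \in D -> fsnoc t o \in pow_dom n.+1.
Proof.
move=> /pow_domP tD oD; apply/pow_domP=> i.
by case: (unliftP ord_max i) => [j ->|->]; rewrite ?fsnoc_lift ?fsnoc_max.
Qed.

Lemma fsnocP n (t : {ffun 'I_n.+1 -> I}) : t \in pow_dom n.+1 ->
  exists t' o, [/\ t' \in pow_dom n, o \in D & t = fsnoc t' o].
Proof.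
move=> /pow_domP tD; exists [ffun i => t (lift ord_max i)], (t ord_max).
split=> //; first by apply/pow_domP=> i; rewrite ffunE.
apply/ffunP=> i; case: (unliftP ord_max i) => [j ->|->].
  by rewrite fsnoc_lift ffunE.
by rewrite fsnoc_max.
Qed.

Lemma pow_basis_snoc n (t : {ffun 'I_n.+1 -> I}) o :
  pow_basis (fsnoc t o) = tens (pow_basis t) (b o) :> ztens (tpow V n.+1) V.
Proof.
rewrite /pow_basis tprodS fsnoc_max; congr (tens (tprod _) _).
by apply: funext => i; rewrite fsnoc_lift.
Qed.

Lemma pow_deg_snoc n (t : {ffun 'I_n -> I}) o :
  pow_deg (fsnoc t o) = (pow_deg t * deg o)%g.
Proof.
rewrite /pow_deg big_ord_lift_max fsnoc_max; congr (_ * _)%g.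
by apply: eq_bigr => i _; rewrite fsnoc_lift.
Qed.

Lemma pow_monomial_basis n :
  monomial_basis (pow_dom n.+1) (@pow_basis n.+1) (@pow_deg n.+1) (@pow_act n.+1).
Proof.
split.
- elim: n => [|n IH] g.
    split=> [v [t [/pow_domP tD <- ->]]|U UP].
      by rewrite /pow_deg big_ord1; exact: (mb_deg bV).
    apply: (mb_gen bV g).2 => v [i [iD iE ->]]; apply: UP.
    exists [ffun=> i]; split; first by apply/pow_domP=> j; rewrite ffunE.
      by rewrite /pow_deg big_ord1 ffunE.
    by rewrite /pow_basis /= ffunE.
  split=> [v [t [/fsnocP[t' [o [tD oD ->]]] <- ->]]|U UP].
    rewrite pow_basis_snoc pow_deg_snoc; apply: ztens_deg; last exact: (mb_deg bV).
    by apply: (IH _).1; exists t'.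
  apply: (tens_gen_gen IH (mb_gen bV) g).2.
  move=> _ [h [k [v [v' [[t [tD tE ->]] [o [oD oE ->]] kE ->]]]]]; apply: UP.
  by exists (fsnoc t o); rewrite pow_basis_snoc fsnoc_dom // pow_deg_snoc tE oE.
- move=> t /pow_domP tD.
  have /choice[c cE] i : exists c : 'Hom(V, F^o),
      forall j, j \in D -> c (b j) = (t i == j)%:R.
    exact: (mb_dual bV).
  have [C CE] := tprod_dual c; exists C => t' /pow_domP t'D.
  rewrite CE; under eq_bigr do rewrite cE //.
  have [->|N] := eqVneq t t'; first by rewrite big1 // => i _; rewrite eqxx.
  have /existsP[i iN] : [exists i, t i != t' i].
    rewrite -negb_forall; apply: contra N => /forallP E.
    by apply/eqP/ffunP=> i; apply/eqP/E.
  by apply/eqP/prodf_eq0; exists i; rewrite ?(negbTE iN).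
- move=> g t /pow_domP tD; split.
    by apply/pow_domP=> i; rewrite ffunE; apply: (mb_act bV g (tD i)).1.
  have [c c0 cE] := tprod_act g (fun i => mb_deg bV (tD i)).
  have /choice[e eE] i : exists e, e != 0 /\ zact V g (b (t i)) = e *: b (act g (t i)).
    by have [_ [e e0 eE]] := mb_act bV g (tD i); exists e.
  exists (c * \prod_i e i).
    by rewrite mulf_neq0 //; apply/prodf_neq0 => i _; apply: (eE i).1.
  rewrite cE -scalerA; congr (_ *: _); apply: tprod_scale => i.
  by rewrite (eE i).2 ffunE.
Qed.

(** The last generator turns the last two labels (o', o) into (g o, o'), where g
    is the degree of b o'; the other generators are reached by induction. *)
Lemma sigma_monomial n i t : t \in pow_dom n.+1 ->
  exists2 t', t' \in pow_dom n.+1 &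
    exists2 c, c != 0 & sigma V n.+1 i (pow_basis t) = c *: pow_basis t'.
Proof.
elim: n t => [|n IH] t.
  by move=> tD; exists t => //; exists 1; rewrite ?oner_eq0 // scale1r id_lfunE.
move=> /fsnocP[t' [o [tD oD ->]]]; rewrite sigmaS pow_basis_snoc.
case: eqP => _; last first.
  have [t'' t''D [c c0 cE]] := IH _ tD; rewrite tens_mapE cE id_lfunE.
  exists (fsnoc t'' o); first exact: fsnoc_dom.
  by exists c => //; rewrite pow_basis_snoc (bilinZl (bl _ _)).
case: n {IH t} t' tD => [|n] t' tD.
  have tD0 := pow_domP _ tD ord0.
  rewrite [sigma_last _ _]/= (zbraidE _ (mb_deg bV tD0)).
  have [aD [c c0 cE]] := mb_act bV (deg (t' ord0)) oD.
  exists (fsnoc [ffun=> act (deg (t' ord0)) o] (t' ord0)).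
    by apply: fsnoc_dom => //; apply/pow_domP=> j; rewrite ffunE.
  exists c => //; rewrite pow_basis_snoc cE (bilinZl (bl _ _)) /pow_basis /=.
  by rewrite ffunE.
case: (fsnocP tD) => s [o' [sD o'D ->]].
have [aD [c c0 cE]] := mb_act bV (deg o') oD.
exists (fsnoc (fsnoc s (act (deg o') o)) o'); first by rewrite !fsnoc_dom.
have sd := (mb_gen (pow_monomial_basis n) _).1 _ (ex_intro _ s (And3 sD erefl erefl)).
rewrite !pow_basis_snoc.
rewrite [sigma_last _ _ _](braid_stepE sd (mb_deg bV o'D) (mb_deg bV oD)).
rewrite cE (bilinZr (bl _ _)) (bilinZl (bl _ _)) scalerA.
by eexists; last by []; rewrite mulf_neq0 // sigma_coef_neq0.
Qed.

End Power.
End TensorPowerBasis.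

(** * The monomial basis of L(H, gamma) *)

Section OrbitBasis.
Variables (F : fieldType) (gT : finGroupType) (w : cocycle3 F gT).
Variables (H : {group gT}) (gamma : trivialization w H).
Local Notation HT := (subg_of H).
Local Notation L := (Lalg gamma).
Implicit Types (x g : gT) (h k f : HT) (p q : gT * HT) (O : {set gT * HT}).

Lemma H_orbitP p q :
  reflect (exists h, q = ((p.1 * (sgval h)^-1)%g, lconj h p.2)) (q \in H_orbit p).
Proof. by apply: (iffP imsetP) => [[h _ ->]|[h ->]]; exists h. Qed.

Lemma H_orbit_refl p : p \in H_orbit p.
Proof. by apply/H_orbitP; exists 1%g; rewrite invg1 mulg1 lconj1g; case: p. Qed.

Lemma H_orbit_sub p q : q \in H_orbit p -> H_orbit q \subset H_orbit p.
Proof.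
move=> /H_orbitP[h ->]; apply/subsetP=> r /H_orbitP[k ->] /=.
by apply/H_orbitP; exists (k * h)%g; rewrite lconjM /= invMg mulgA.
Qed.

Lemma H_orbit_eq p q : q \in H_orbit p -> H_orbit q = H_orbit p.
Proof.
move=> qp; apply/eqP; rewrite eqEsubset !H_orbit_sub //.
case/H_orbitP: qp => h ->; apply/H_orbitP; exists h^-1%g => /=.
by rewrite invgK mulgKV -lconjM mulVg lconj1g; case: p.
Qed.

Lemma GxHH_orbit O p : O \in GxHH H -> p \in O -> O = H_orbit p.
Proof. by move=> /imsetP[q _ ->] /H_orbit_eq. Qed.

Definition orbit_deg p : gT := lconj p.1 (sgval p.2).

Lemma orbit_degE p q : q \in H_orbit p -> orbit_deg q = orbit_deg p.
Proof.
case/H_orbitP=> h ->.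
rewrite -[LHS]/(lconj (p.1 * (sgval h)^-1)%g (lconj (sgval h) (sgval p.2))).
by rewrite -lconjM mulgKV.
Qed.

Definition Lcoord p (a : L) : F^o := (vsval a : maps F H) p.1 p.2.

Lemma Lcoord_linear p : linear (Lcoord p).
Proof. by move=> c a b; rewrite /Lcoord linearP !ffunE. Qed.

HB.instance Definition _ p :=
  GRing.isLinear.Build F L F^o *:%R (Lcoord p) (@Lcoord_linear p).

Lemma CH_act_coord h k (v : CH F H) :
  CH_act gamma h v (lconj h k) = v k * eps gamma h k.
Proof.
rewrite CH_actE sum_ffunE (bigD1 k) //= big1 ?addr0 => [|l lk].
  by rewrite !ffunE eqxx /GRing.scale /= mulr1.
by rewrite !ffunE (inj_eq (@lconj_inj _ h)) eq_sym (negbTE lk) scaler0.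
Qed.

(** The scalar relating the coordinates of an element of L at two points of one
    H-orbit; see Lcoord_transport. *)
Definition transport_coef x h k : F :=
  omega_act w (sgval h)^-1%g x^-1%g (lconj x (sgval k)) * eps gamma h^-1%g k.

(** The condition that defines L, read in coordinates.  That condition refers to
    the degree of a, but a homogeneous a of degree f is nonzero at (x, k) only if
    f = x k x^-1, so the degree can be eliminated and the relation holds for all
    elements of L. *)
Lemma Lcoord_transport x h k (a : L) :
  Lcoord ((x * sgval h)%g, lconj h^-1%g k) a = transport_coef x h k * Lcoord (x, k) a.
Proof.
rewrite /Lcoord /=; set y := (x * _)%g; set l := lconj _ _.
pose phi (b : zmaps w H) : F^o :=
  (b : maps F H) y l - transport_coef x h k * (b : maps F H) x k.
have phi_lin : linear phi.
  by move=> c u v; rewrite /phi !ffunE /GRing.scale /=; ring.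
suff /subvP/(_ _ (subvsP a)) : (L_space gamma <= lker (linfun phi))%VS.
  by rewrite memv_ker linfun_linE // subr_eq0 => /eqP.
apply: span_ofS => b [f [/maps_compP bf bL]].
rewrite memv_ker linfun_linE // subr_eq0 /y bL ffunE CH_act_coord; apply/eqP.
rewrite /transport_coef; have [->|bk] := eqVneq ((b : maps F H) x k) 0.
  by rewrite mul0r mulr0 scaler0.
have fE : sgval k = (x^-1 * f * x)%g.
  by apply/eqP; apply: contraR bk => kN; move/mem_CH_comp: (bf x) => ->.
have -> : lconj x (sgval k) = f by rewrite fE /lconj !mulgA mulgV mul1g mulgK.
by rewrite /GRing.scale /= -mulrA [eps _ _ _ * _]mulrC.
Qed.

Lemma eps1 f : eps gamma 1%g f = 1.
Proof.
have nz := gamma_neq0 gamma.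
have E1 : gamma 1%g f = gamma 1%g 1%g.
  have := gamma_cocycle gamma 1%g 1%g f; rewrite !mul1g omega1l.
  move/(congr1 (fun z => z * (gamma 1%g f * gamma 1%g f))).
  by rewrite divfK ?mulf_neq0 // mul1r => /(mulfI (nz _ _)).
have E2 : gamma f 1%g = gamma 1%g 1%g.
  have := gamma_cocycle gamma f 1%g 1%g; rewrite !mulg1 omega1r.
  move/(congr1 (fun z => z * (gamma f 1%g * gamma 1%g 1%g))).
  by rewrite divfK ?mulf_neq0 // mul1r => /(mulfI (nz _ _)).
by rewrite /eps lconj1g E1 E2 divff.
Qed.

Lemma chi_coord_out p q : q \notin H_orbit p -> Lcoord q (chi gamma p.1 p.2) = 0.
Proof.
move=> qN; rewrite /Lcoord /= ffunE; case: ifP => [qH|_]; last by rewrite ffunE.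
rewrite !ffunE; case: eqP => [E|_]; last by rewrite scaler0.
case/negP: qN; apply/H_orbitP; exists (subg H (p.1^-1 * q.1))^-1%g.
rewrite -E; have -> : (sgval (subg H (p.1^-1 * q.1))^-1%g)^-1%g = (p.1^-1 * q.1)%g.
  by rewrite -[LHS]/((sgval (subg H (p.1^-1 * q.1)))^-1^-1)%g invgK [LHS]subgK.
by rewrite mulKVg; case: (q).
Qed.

Lemma chi_coord_id p : Lcoord p (chi gamma p.1 p.2) = 1.
Proof.
rewrite /Lcoord /= ffunE mulVg group1.
have -> : subg H 1 = 1%g by apply: val_inj; rewrite /= subgK.
cbv zeta; rewrite (invg1 (subg_of H)) lconj1g !ffunE eqxx eps1.
rewrite -[sgval 1%g]/(1%g : gT) invg1 /omega_act !omega_norm !omega1l.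
by rewrite /GRing.scale /= !mulr1 divr1.
Qed.

(** An element of L is determined on an H-orbit by its value at one point, so
    the support decides proportionality to a chi.  This replaces all explicit
    computations of the scalars relating the chi's. *)
Lemma orbit_supported p (a : L) : (forall q, q \notin H_orbit p -> Lcoord q a = 0) ->
  a = Lcoord p a *: chi gamma p.1 p.2.
Proof.
move=> a0; apply: val_inj; apply/ffunP=> x; apply/ffunP=> k.
(* Equality in L is equality of all coordinates. *)
rewrite -[LHS]/(Lcoord (x, k) a).
rewrite -[RHS]/(Lcoord (x, k) (Lcoord p a *: chi gamma p.1 p.2)).
rewrite linearZ /=.
have [|N] := boolP ((x, k) \in H_orbit p); last first.
  by rewrite a0 // chi_coord_out // scaler0.
case/H_orbitP=> h [-> ->].
have T := Lcoord_transport p.1 h^-1%g p.2; rewrite invgK in T.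
have -> : (sgval h)^-1%g = sgval h^-1%g by [].
rewrite !T; case: p {a0 T} => x0 k0 /=.
by rewrite (chi_coord_id (x0, k0)) mulr1 /GRing.scale /= mulrC.
Qed.

(** Independence of the representative: the two chi's have the same support. *)
Lemma chi_orbit p q : q \in H_orbit p ->
  exists2 c, c != 0 & chi gamma q.1 q.2 = c *: chi gamma p.1 p.2.
Proof.
move=> qp; have E := H_orbit_eq qp.
have S : chi gamma q.1 q.2 = Lcoord p (chi gamma q.1 q.2) *: chi gamma p.1 p.2.
  by apply: orbit_supported => r; rewrite -E => /chi_coord_out.
exists (Lcoord p (chi gamma q.1 q.2)) => //; apply/negP=> /eqP c0.
have := chi_coord_id q; rewrite S c0 scale0r linear0 => /eqP.
by rewrite eq_sym oner_eq0.
Qed.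

Lemma mem_Ldeg g (a : L) : (a \in zdeg L g) = (vsval a \in zdeg (zmaps w H) g).
Proof. exact: mem_sub_comp. Qed.

Lemma vsval_Lact g (a : L) : vsval (zact L g a) = zact (zmaps w H) g (vsval a).
Proof. exact: (sub_actE (@L_stable _ _ _ _ gamma)). Qed.

Lemma chi_deg p : chi gamma p.1 p.2 \in zdeg L (orbit_deg p).
Proof. by rewrite mem_Ldeg; exact: (chi_L_cond gamma p.1 p.2).1. Qed.

Lemma Lcoord_act g x k (d : gT) (a : L) : a \in zdeg L d ->
  Lcoord (x, k) (zact L g a) =
    (omega_act w x^-1%g g d)^-1 * Lcoord ((g^-1 * x)%g, k) a.
Proof.
by rewrite mem_Ldeg => af; rewrite /Lcoord vsval_Lact (maps_actE _ _ _ af) ffunE.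
Qed.

(** Acting by g translates the support by g on the first component. *)
Lemma chi_act g p : exists2 c, c != 0 &
  zact L g (chi gamma p.1 p.2) = c *: chi gamma (g * p.1)%g p.2.
Proof.
have A x k := Lcoord_act g x k (chi_deg p).
exists (Lcoord ((g * p.1)%g, p.2) (zact L g (chi gamma p.1 p.2))).
  rewrite A mulKg -surjective_pairing.
  by rewrite chi_coord_id mulr1 invr_eq0 omega_act_neq0.
apply: (@orbit_supported ((g * p.1)%g, p.2)) => -[x k] N.
rewrite A chi_coord_out ?mulr0 //; apply: contra N => /H_orbitP[h [xE ->]].
by apply/H_orbitP; exists h; rewrite /= -mulgA -xE mulKVg.
Qed.

Definition orbit_translate g O : {set gT * HT} := [set ((g * p.1)%g, p.2) | p in O].

Lemma orbit_translateE g p : orbit_translate g (H_orbit p) = H_orbit ((g * p.1)%g, p.2).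
Proof.
apply/setP=> q; apply/imsetP/H_orbitP=> [[r /H_orbitP[h ->] ->]|[h ->]].
  by exists h; rewrite /= mulgA.
exists ((p.1 * (sgval h)^-1)%g, lconj h p.2); first by apply/H_orbitP; exists h.
by rewrite /= mulgA.
Qed.

Lemma orbit_translate1 O : orbit_translate 1%g O = O.
Proof.
rewrite -[RHS]imset_id; apply: eq_imset => -[x k]; by rewrite /= mul1g.
Qed.

Lemma orbit_translateM g g' O :
  orbit_translate (g * g')%g O = orbit_translate g (orbit_translate g' O).
Proof.
by rewrite /orbit_translate -imset_comp; apply: eq_imset => q; rewrite /= mulgA.
Qed.

(** The pair (1, 1) is a dummy value, used only for the empty set. *)
Definition orbit_rep O : gT * HT := odflt (1%g, 1%g) [pick p in O].

Lemma orbit_repP O : O \in GxHH H -> orbit_rep O \in O.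
Proof.
move=> OH; rewrite /orbit_rep; case: pickP => //= O0.
by case/imsetP: OH => p _ OE; have := O0 p; rewrite OE H_orbit_refl.
Qed.

Lemma orbit_repE O : O \in GxHH H -> H_orbit (orbit_rep O) = O.
Proof. by move=> OH; rewrite -(GxHH_orbit OH (orbit_repP OH)). Qed.

Lemma mem_GxHH p : H_orbit p \in GxHH H.
Proof. exact: imset_f. Qed.

Definition chi_basis O : L := chi gamma (orbit_rep O).1 (orbit_rep O).2.

Lemma chi_basis_mem O p : O \in GxHH H -> p \in O ->
  exists2 c, c != 0 & chi gamma p.1 p.2 = c *: chi_basis O.
Proof. by move=> OH pO; apply: chi_orbit; rewrite orbit_repE. Qed.

Lemma chi_basis_coord O O' : O \in GxHH H -> O' \in GxHH H ->
  Lcoord (orbit_rep O) (chi_basis O') = (O == O')%:R.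
Proof.
move=> OH O'H; have [->|N] := eqVneq; first exact: chi_coord_id.
apply: chi_coord_out; apply: contra N => /H_orbit_eq.
by rewrite !orbit_repE // => ->.
Qed.

(** At a point q only the term of the H-orbit of q is nonzero, and there both
    sides transport the same value from the representative of that orbit. *)
Lemma chi_basis_expand (a : L) :
  a = \sum_(O in GxHH H) Lcoord (orbit_rep O) a *: chi_basis O.
Proof.
apply: val_inj; apply/ffunP=> x; apply/ffunP=> k.
rewrite -[LHS]/(Lcoord (x, k) a) -[RHS]/(Lcoord (x, k) (\sum_(O in GxHH H) _)).
have H1 := mem_GxHH (x, k); set O := H_orbit (x, k) in H1.
rewrite linear_sum (bigD1 O) //= big1 ?addr0 => [|O' /andP[O'H O'N]].
  have : (x, k) \in H_orbit (orbit_rep O) by rewrite orbit_repE ?H_orbit_refl.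
  case/H_orbitP=> h [xE kE]; rewrite linearZ /= xE kE.
  have T := Lcoord_transport (orbit_rep O).1 h^-1%g (orbit_rep O).2.
  rewrite invgK in T; have -> : (sgval h)^-1%g = sgval h^-1%g by [].
  rewrite !T /chi_basis -surjective_pairing chi_coord_id mulr1.
  by rewrite /GRing.scale /= mulrC.
rewrite linearZ /= chi_coord_out ?scaler0 // orbit_repE //.
by apply: contra O'N => /(GxHH_orbit O'H) ->.
Qed.

Lemma chi_monomial_basis :
  monomial_basis (GxHH H) chi_basis (fun O => orbit_deg (orbit_rep O)) orbit_translate.
Proof.
split.
- move=> g; split=> [v [O [OH <- ->]]|U UP]; first exact: chi_deg.
  apply/subvP=> a ag; rewrite [a]chi_basis_expand; apply: memv_suml => O OH.
  have [->|a0] := eqVneq (Lcoord (orbit_rep O) a) 0; first by rewrite scale0r mem0v.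
  apply/memvZ/UP; exists O; split=> //; apply: contraNeq a0 => dN.
  move: ag; rewrite mem_Ldeg => /maps_compP/(_ (orbit_rep O).1)/mem_CH_comp.
  move=> /(_ (orbit_rep O).2) E; apply/eqP/E; apply: contra dN => /eqP kE.
  by rewrite /orbit_deg kE /lconj !mulgA mulgV mul1g mulgK.
- move=> O OH; exists (linfun (Lcoord (orbit_rep O))) => O' O'H.
  by rewrite lfunE /= chi_basis_coord.
- move=> g O OH; have AH : orbit_translate g O \in GxHH H.
    by rewrite -(orbit_repE OH) orbit_translateE mem_GxHH.
  split=> //; have [c c0 cE] := chi_act g (orbit_rep O).
  have [|e e0 eE] := @chi_basis_mem _ ((g * (orbit_rep O).1)%g, (orbit_rep O).2) AH.
    by rewrite -[X in orbit_translate g X](orbit_repE OH) orbit_translateE H_orbit_refl.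
  by exists (c * e); rewrite ?mulf_neq0 // cE eE scalerA.
Qed.

End OrbitBasis.

Lemma vlineZ (F : fieldType) (V : vectType F) (c : F) (v : V) :
  c != 0 -> <[c *: v]>%VS = <[v]>%VS.
Proof.
move=> c0; apply/eqP; rewrite eqEsubv -!memvE (memvZ _ (memv_line v)) /=.
by rewrite -[X in X \in _](scalerK c0) memvZ ?memv_line.
Qed.

(** * Invariants of a monomial action *)

Section Invariants.
Variables (F : fieldType) (gT : finGroupType) (w : cocycle3 F gT) (T : zobj w).
Variables (I : finType) (D : {set I}) (b : I -> T) (deg : I -> gT).
Variable act : gT -> I -> I.
Hypothesis char0 : [pchar F] =i pred0.
Hypothesis bT : monomial_basis D b deg act.
Hypotheses (act1 : forall i, act 1%g i = i)
  (actM : forall g h i, act (g * h)%g i = act g (act h i)).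

Local Notation Hom := (zHom (zunit w) T).

(** In degree 1 the twisted action is an action. *)
Lemma zactM1 g h u : u \in zdeg T 1%g -> zact T (g * h)%g u = zact T g (zact T h u).
Proof. by move=> u1; rewrite (zactM _ _ u1) omega_act_1 scale1r. Qed.

Lemma zact_deg1 g u : u \in zdeg T 1%g -> zact T g u \in zdeg T 1%g.
Proof. by move/(zact_deg g); rewrite /lconj mulg1 mulgV. Qed.

Definition avg u : T := \sum_g zact T g u.

Lemma avg_act g u : u \in zdeg T 1%g -> avg (zact T g u) = avg u.
Proof.
move=> u1; rewrite [RHS](reindex_inj (mulIg g)); apply: eq_bigr => h _.
by rewrite zactM1.
Qed.

Lemma act_avg g u : u \in zdeg T 1%g -> zact T g (avg u) = avg u.
Proof.
move=> u1; rewrite [RHS](reindex_inj (mulgI g)) linear_sum; apply: eq_bigr => h _.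
by rewrite zactM1.
Qed.

Lemma avgZ a u : avg (a *: u) = a *: avg u.
Proof. by rewrite scaler_sumr; apply: eq_bigr => g _; rewrite linearZ. Qed.

Lemma avg_deg u : u \in zdeg T 1%g -> avg u \in zdeg T 1%g.
Proof. by move=> u1; apply: memv_suml => g _; apply: zact_deg1. Qed.

Lemma natr_neq0 m : (0 < m)%N -> m%:R != 0 :> F.
Proof. by move=> m0; rewrite (iffLR (pcharf0P F) char0) -lt0n. Qed.

Definition neutral : {set I} := [set t in D | deg t == 1%g].
Definition act_orbit t : {set I} := [set act g t | g : gT].
Definition is_regular t := forall g, act g t = t -> zact T g (b t) = b t.
Definition reg_orbits : {set {set I}} :=
  [set act_orbit t | t in neutral & `[< is_regular t >]].

Lemma neutralP t : t \in neutral -> t \in D /\ b t \in zdeg T 1%g.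
Proof.
by rewrite inE => /andP[tD /eqP t1]; split=> //; rewrite -t1; exact: (mb_deg bT).
Qed.

Lemma basis_neq0 t : t \in D -> b t != 0.
Proof.
move=> tD; have [c cE] := mb_dual bT tD; have := cE _ tD.
by rewrite eqxx; apply: contra_eqN => /eqP->; rewrite linear0 eq_sym oner_eq0.
Qed.

(** A nonzero vector is homogeneous of one degree only. *)
Lemma neutral_deg t : t \in D -> b t \in zdeg T 1%g -> t \in neutral.
Proof.
move=> tD t1; rewrite inE tD /=; apply/negPn; apply: contraL (basis_neq0 tD) => N.
have := hpartE (deg t) t1; rewrite (negbTE N) (hpartE _ (mb_deg bT tD)) eqxx.
by move=> ->; rewrite negbK.
Qed.

Lemma avg_orbit t t' : t \in neutral -> t' \in act_orbit t ->
  exists2 c, c != 0 & avg (b t') = c *: avg (b t).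
Proof.
move=> /neutralP[tD t1] /imsetP[g _ ->]; have [_ [c c0 cE]] := mb_act bT g tD.
exists c^-1; first by rewrite invr_eq0.
by rewrite -(avg_act g t1) cE avgZ scalerA mulVf ?scale1r.
Qed.

(** A stabilizing g that acts on the line by c <> 1 gives m = c m for the average
    m. *)
Lemma avg_irregular t : t \in neutral -> ~ is_regular t -> avg (b t) = 0.
Proof.
move=> tN /existsNP[g /not_implyP[gt N]]; have [tD t1] := neutralP tN.
have [_ [c _ cE]] := mb_act bT g tD; rewrite gt in cE.
have : avg (b t) = c *: avg (b t) by rewrite -avgZ -cE avg_act.
move/eqP; rewrite -subr_eq0 -{1}[avg _]scale1r -scalerBl scaler_eq0 subr_eq0.
case/orP=> /eqP // c1; case: N; by rewrite cE -c1 scale1r.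
Qed.

Lemma coord_avg_out t t' (c : 'Hom(T, F^o)) : t \in neutral -> t' \in neutral ->
  (forall j, j \in D -> c (b j) = (t == j)%:R) -> t \notin act_orbit t' ->
  c (avg (b t')) = 0.
Proof.
move=> /neutralP[tD _] /neutralP[t'D _] cE N; rewrite linear_sum big1 // => g _.
have [aD [e _ eE]] := mb_act bT g t'D; rewrite eE linearZ /= cE //.
case: eqP => [E|_]; last by rewrite scaler0.
by case/negP: N; rewrite E imset_f.
Qed.

(** The coefficient of b t in its average is the order of the stabilizer of t,
    nonzero in characteristic 0. *)
Lemma coord_avg_regular t (c : 'Hom(T, F^o)) : t \in neutral -> is_regular t ->
  (forall j, j \in D -> c (b j) = (t == j)%:R) -> c (avg (b t)) != 0.
Proof.
move=> /neutralP[tD _] tR cE; rewrite linear_sum.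
rewrite (eq_bigr (fun g => (act g t == t)%:R)) => [|g _].
  by rewrite -natr_sum natr_neq0 // (bigD1 1%g) //= act1 eqxx.
have [aD [e _ eE]] := mb_act bT g tD.
have [E|N] := eqVneq (act g t) t; first by rewrite tR //= cE ?eqxx.
by rewrite eE linearZ /= cE // eq_sym (negbTE N) scaler0.
Qed.

Lemma mem_act_orbit t : t \in act_orbit t.
Proof. by apply/imsetP; exists 1%g; rewrite ?act1. Qed.

Lemma act_orbit_eq t t' : t' \in act_orbit t -> act_orbit t' = act_orbit t.
Proof.
have S s s' : s' \in act_orbit s -> act_orbit s' \subset act_orbit s.
  move=> /imsetP[g _ ->]; apply/subsetP=> r /imsetP[h _ ->].
  by rewrite -actM imset_f.
move=> tt'; apply/eqP; rewrite eqEsubset !S //; case/imsetP: tt' => g _ ->.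
by apply/imsetP; exists g^-1%g; rewrite // -actM mulVg act1.
Qed.

Definition point u : 'Hom(zunit w, T) := linfun (fun z : F^o => (z : F) *: u).

Lemma pointE u (z : F^o) : point u z = (z : F) *: u.
Proof. by rewrite /point linfun_linE // => a x y; rewrite scalerDl scalerA. Qed.

Lemma point_zmor u : u \in zdeg T 1%g -> (forall g, zact T g u = u) ->
  point u \in Hom.
Proof.
move=> u1 ua; apply/zHomP; split=> [g v|g v]; last first.
  by rewrite [zact (zunit w) g v]id_lfunE !pointE linearZ /= ua.
rewrite /= /unit_comp; case: eqP => [-> _|_]; first by rewrite pointE memvZ.
by rewrite memv0 => /eqP->; rewrite linear0 mem0v.
Qed.

(** Together with point_zmor: evaluation at 1 identifies Hom(1, T) with the
    invariants of degree 1. *)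
Lemma zmor_point (f : subvs_of Hom) (u := vsval f (1 : F^o)) :
  [/\ u \in zdeg T 1%g, forall g, zact T g u = u & vsval f = point u].
Proof.
have /zHomP[fd fa] := subvsP f; split.
- by apply: fd; rewrite /= /unit_comp eqxx memvf.
- by move=> g; rewrite -fa [zact (zunit w) g _]id_lfunE.
- apply/lfunP=> z; rewrite pointE -linearZ /=; congr (vsval f _).
  by rewrite /GRing.scale /= mulr1.
Qed.

Definition avg_hom t : subvs_of Hom := vsproj Hom (point (avg (b t))).

Lemma avg_homE t : t \in neutral -> vsval (avg_hom t) = point (avg (b t)).
Proof.
move=> /neutralP[_ t1]; rewrite vsprojK // point_zmor ?avg_deg // => g.
exact: act_avg.
Qed.

Lemma avg_hom1 t : t \in neutral -> vsval (avg_hom t) (1 : F^o) = avg (b t).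
Proof. by move=> tN; rewrite avg_homE // pointE scale1r. Qed.

Lemma hom_ext (f f' : subvs_of Hom) :
  vsval f (1 : F^o) = vsval f' (1 : F^o) -> f = f'.
Proof.
have [_ _ E] := zmor_point f; have [_ _ E'] := zmor_point f'.
by move=> ff'; apply: val_inj; rewrite /= E E' ff'.
Qed.

Lemma eval_point_linear : linear (fun f : subvs_of Hom => vsval f (1 : F^o)).
Proof. by move=> a f f'; rewrite linearP add_lfunE scale_lfunE. Qed.

Definition eval_point : 'Hom(subvs_of Hom, T) :=
  linfun (fun f : subvs_of Hom => vsval f (1 : F^o)).

Lemma eval_pointE f : eval_point f = vsval f (1 : F^o).
Proof. exact: (linfun_linE eval_point_linear). Qed.

Lemma orbit_rep_ex (x : {O | O \in reg_orbits}) :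
  exists t, [/\ t \in neutral, is_regular t & val x = act_orbit t].
Proof.
case: x => O /= /imsetP[t]; rewrite inE => /andP[tN /asboolP tR] ->.
by exists t.
Qed.

(** The lines are spanned by the averages of one basis vector from each regular
    orbit.  The second clause concerns any invertible morphism S that permutes
    the basis up to scalars: it maps averages to averages, up to a scalar, and
    as these stay nonzero the orbits that occur are again regular. *)
Theorem regular_orbit_lines :
  exists line : {O | O \in reg_orbits} -> {vspace subvs_of Hom},
  monomial_space line /\
  forall (S : 'End(T)) (P : 'End(subvs_of Hom)), is_zmor S -> lker S == 0%VS ->
    (forall f, vsval (P f) = (S \o vsval f)%VF) ->
    (forall t, t \in D -> exists2 t', t' \in D &
       exists2 c, c != 0 & S (b t) = c *: b t') ->
    forall x, exists y, (P @: line x)%VS = line y.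
Proof.
have [r rP] := choice orbit_rep_ex.
pose line x := <[avg_hom (r x)]>%VS; exists line.
have nz t : t \in neutral -> is_regular t -> avg (b t) != 0.
  move=> tN tR; have [c cE] := mb_dual bT (neutralP tN).1.
  have := coord_avg_regular tN tR cE.
  by apply: contraNneq => ->; rewrite linear0.
(* Any regular t, not only a chosen representative, spans one of the lines. *)
have span t : t \in neutral -> is_regular t ->
    exists x, <[avg_hom t]>%VS = line x.
  move=> tN tR; have tO : act_orbit t \in reg_orbits.
    by apply/imsetP; exists t; rewrite // inE tN; apply/asboolP.
  pose x : {O | O \in reg_orbits} := exist _ (act_orbit t) tO; exists x.
  have [rN rR rE] := rP x.
  have [c c0 cE] : exists2 c, c != 0 & avg (b t) = c *: avg (b (r x)).
    by apply: avg_orbit => //; rewrite -rE mem_act_orbit.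
  have -> : avg_hom t = c *: avg_hom (r x).
    by apply: hom_ext; rewrite linearZ /= scale_lfunE !avg_hom1.
  exact: vlineZ.
split; first split; [|split|].
- move=> x; have [rN rR _] := rP x; rewrite dim_vline; case: eqP => // E.
  by have := nz _ rN rR; rewrite -avg_hom1 // E /= zero_lfunE eqxx.
- apply/eqP; rewrite eq_sym eqEsubv subvf /=; apply/subvP=> f _.
  (* An invariant u is its own average divided by the order of G, and averages
     of vectors of degree 1 lie in the sum of the lines. *)
  have [f1 fa _] := zmor_point f; set u := vsval f _ in f1 fa.
  have G0 : #|gT|%:R != 0 :> F by apply: natr_neq0; apply/card_gt0P; exists 1%g.
  have avu : avg u = #|gT|%:R *: u.
    by rewrite /avg (eq_bigr (fun=> u)) // sumr_const scaler_nat.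
  pose A : 'End(T) := linfun avg.
  have AE v : A v = avg v.
    apply: linfun_linE => a y z; rewrite /avg scaler_sumr -big_split /=.
    by apply: eq_bigr => g _; rewrite linearP.
  have: u \in (A @^-1: (eval_point @: \sum_x line x))%VS.
    apply: subvP _ f1; apply: (mb_gen bT 1%g).2 => v [t [tD t1 ->]].
    have tN : t \in neutral by rewrite inE tD t1 eqxx.
    rewrite -memv_preim AE.
    have [tR|/avg_irregular->//] := pselect (is_regular t); last by rewrite mem0v.
    have [x xE] := span _ tN tR.
    rewrite -avg_hom1 // -eval_pointE memv_img //.
    by apply: (subvP (sumv_sup x _ (subvv _))) => //; rewrite -xE memv_line.
  rewrite -memv_preim AE avu => /memv_imgP[f' f'L]; rewrite eval_pointE => E.
  have -> : f = #|gT|%:R^-1 *: f'; last by rewrite memvZ.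
  by apply: hom_ext; rewrite linearZ /= scale_lfunE -E scalerA mulVf // scale1r.
- apply/directv_sum_independent => us usL us0 x _.
  (* Apply the coordinate at the representative of x to the vanishing sum. *)
  have [rN rR rE] := rP x; have [c cE] := mb_dual bT (neutralP rN).1.
  have /vlineP[a aE] := usL x isT.
  have := congr1 (fun f => c (eval_point f)) us0.
  rewrite /= !linear_sum (bigD1 x) //= big1 ?addr0 => [|y yx].
    rewrite aE linearZ /= eval_pointE avg_hom1 // !linear0 linearZ /= => /eqP.
    rewrite mulf_eq0 (negbTE (coord_avg_regular rN rR cE)) orbF => /eqP->.
    by rewrite scale0r.
  have [yN yR yE] := rP y; have /vlineP[e ->] := usL y isT.
  rewrite linearZ /= eval_pointE avg_hom1 // linearZ /=.
  rewrite (coord_avg_out rN yN cE) ?scaler0 //.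
  apply: contra yx => /act_orbit_eq E; apply/eqP/val_inj.
  by rewrite yE rE E.
move=> S P Sz S0 PE Sb x; have [rN rR _] := rP x; have [rD r1] := neutralP rN.
have [t' t'D [c c0 cE]] := Sb _ rD.
have Savg : S (avg (b (r x))) = c *: avg (b t').
  rewrite linear_sum -avgZ -cE; apply: eq_bigr => g _; exact: Sz.2.
have t'1 : b t' \in zdeg T 1%g.
  by rewrite -[b t'](scalerK c0) -cE memvZ //; apply: Sz.1.
have t'N := neutral_deg t'D t'1.
have t'R : is_regular t'.
  apply: contrapT => /(avg_irregular t'N) E; have := nz _ rN rR.
  rewrite E scaler0 in Savg.
  by rewrite -memv0 -(eqP S0) memv_ker Savg eqxx.
have [y yE] := span _ t'N t'R; exists y; rewrite limg_line -yE.
have -> : P (avg_hom (r x)) = c *: avg_hom t'.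
  apply: hom_ext; rewrite PE comp_lfunE avg_hom1 // Savg.
  by rewrite linearZ /= scale_lfunE avg_hom1.
exact: vlineZ.
Qed.

End Invariants.

Lemma monomial_space_dim (F : fieldType) (V : vectType F) (X : finType)
    (line : X -> {vspace V}) : monomial_space line -> \dim {:V} = #|X|.
Proof.
case=> line1 [-> /directvP] /= ->.
by rewrite (eq_bigr (fun=> 1%N)) ?sum1_card // => x _; rewrite line1.
Qed.

(** * Representations of the braid group *)

Section BraidRepresentation.
Variables (F : fieldType) (V : vectType F) (n : nat) (S : 'I_n.-1 -> 'End(V)).
Hypothesis S_inj : forall i, lker (S i) == 0%VS.
Hypothesis S_comm : forall i j : 'I_n.-1, (i.+1 < j)%N ->
  (S i \o S j = S j \o S i)%VF.
Hypothesis S_yb : forall i j : 'I_n.-1, j = i.+1 :> nat ->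
  (S i \o (S j \o S i) = S j \o (S i \o S j))%VF.

Let letter (x : 'I_n.-1 * bool) : 'End(V) := if x.2 then (S x.1)^-1%VF else S x.1.

Let eval (u : braid_word n) : 'End(V) :=
  foldr (fun x f => letter x \o f)%VF \1%VF u.

Let eval_cat u v : eval (u ++ v) = (eval u \o eval v)%VF.
Proof.
by elim: u => [|x u IH] /=; rewrite ?comp_lfun1l // IH comp_lfunA.
Qed.

Let eval_rel u v : braid_rel u v -> eval u = eval v.
Proof.
elim=> {u v} // [u v t _ -> _ -> //|u u' v v' _ E _ E'|i b|i j ij|i j ij].
- by rewrite !eval_cat E E'.
- rewrite /eval /= comp_lfun1r /letter /=; apply/lfunP=> x.
  by case: b; rewrite /= comp_lfunE id_lfunE ?lker0_lfunK ?lker0_lfunVK.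
- by rewrite /eval /= !comp_lfun1r /letter /= S_comm.
- by rewrite /eval /= !comp_lfun1r /letter /= S_yb.
Qed.

(** Words are evaluated letter by letter, a barred letter as the inverse
    operator; the defining relations make the value independent of the word. *)
Lemma braid_representation : exists rho : braid_group n -> 'End(V),
  representation rho /\ forall i, rho (braid_gen i) = S i.
Proof.
have E u : eval (repr (\pi_(braid_group n) u)) = eval u.
  by apply: eval_rel; apply/braid_piP; rewrite reprK.
exists (fun a => eval (repr a)); split; first split.
- exact: (E [::]).
- by move=> a b; rewrite -eval_cat; exact: E.
- by move=> i; rewrite [LHS]E /eval /= comp_lfun1r.
Qed.

End BraidRepresentation.

Lemma braid_group_ind n (P : braid_group n -> Prop) :
  P 1%g -> (forall i, P (braid_gen i)) -> (forall a b, P a -> P b -> P (a * b)%g) ->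
  (forall a, P a -> P a^-1%g) -> forall a, P a.
Proof.
move=> P1 Pg PM PV; elim/quotW=> u; elim: u => [|[i s] u IH]; first exact: P1.
have -> : \pi_(braid_group n) ((i, s) :: u) =
    ((\pi_(braid_group n) [:: (i, s)]) * \pi_(braid_group n) u)%g.
  by rewrite -cat1s -braid_mulE.
apply: PM => //; case: s; last exact: Pg.
have -> : \pi_(braid_group n) [:: (i, true)] = (braid_gen i)^-1%g.
  apply: (mulgI (braid_gen i)); rewrite mulgV.
  transitivity (\pi_(braid_group n) ([:: (i, false)] ++ [:: (i, true)])).
    exact: braid_mulE.
  by apply/braid_piP; apply: (braid_cancel i false).
exact/PV/Pg.
Qed.

Section PermutedLines.
Variables (F : fieldType) (V : vectType F) (X : finType) (line : X -> {vspace V}).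
Hypothesis ms : monomial_space line.

Lemma line_inj : injective line.
Proof.
move=> x y xy; apply/eqP; apply: contraT => N; have [l1 [_ dir]] := ms.
suff : line x == 0%VS by rewrite -dimv_eq0 l1.
rewrite -(directv_sumP dir x isT) eq_sym; apply/eqP/capv_idPl.
by rewrite xy; apply: (sumv_sup y); rewrite ?subvv // eq_sym.
Qed.

(** On generators it suffices that lines go to lines: since the lines are
    distinct and the operators invertible, the induced map on the index set is
    injective, hence a permutation.  Permutations then handle inverses, for
    which no direct information is given. *)
Lemma braid_permutes_lines n (rho : braid_group n -> 'End(V)) :
  representation rho ->
  (forall i x, exists y, (rho (braid_gen i) @: line x)%VS = line y) ->
  monomial_rep rho line.
Proof.
move=> [rho1 rhoM] gen; split=> //.
elim/braid_group_ind => [|i|a b [s sE] [t tE]|a [s sE]].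
- by exists 1%g => x; rewrite rho1 lim1g perm1.
- have [y yE] := choice (gen i).
  suff y_inj : injective y by exists (perm y_inj) => x; rewrite permE yE.
  move=> x x' xx'; apply: line_inj.
  have K U : (rho (braid_gen i)^-1%g @: (rho (braid_gen i) @: U))%VS = U.
    by rewrite -limg_comp -rhoM mulVg rho1 lim1g.
  by rewrite -[line x]K -[line x']K !yE xx'.
- by exists (t * s)%g => x; rewrite rhoM limg_comp tE sE permM.
- exists s^-1%g => x; rewrite -[x in LHS](permKV s) -sE -limg_comp -rhoM mulVg.
  by rewrite rho1 lim1g.
Qed.

End PermutedLines.

(** * Braid group action on Hom(1, L(H, gamma)^n) *)

Section Corollary.
Variables (F : fieldType) (gT : finGroupType) (w : cocycle3 F gT).
Variables (H : {group gT}) (gamma : trivialization w H) (n : nat).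
Hypothesis char0 : [pchar F] =i pred0.
Local Notation L := (Lalg gamma).
Local Notation T := (tpow L n.+1).
Local Notation I := {ffun 'I_n.+1 -> {set gT * subg_of H}}.
Local Notation D := (pow_dom (GxHH H) n.+1).
Local Notation b := (@pow_basis _ _ _ L _ (chi_basis gamma) n.+1).
Local Notation deg := (pow_deg (fun O => orbit_deg (@orbit_rep _ H O)) (n := n.+1)).

(** The product of the conjugates does not depend on the representatives, so it
    may be computed with the chosen ones. *)
Lemma GxHH_eE : GxHH_e H n.+1 = neutral D deg.
Proof.
apply/setP=> t; rewrite !inE; have [tD|//] := boolP [forall i, t i \in GxHH H].
have tH i : t i \in GxHH H by move/forallP: tD.
have degE p : represents p t ->
    (\prod_i ((p i).1 * sgval (p i).2 * (p i).1^-1))%g = deg t.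
  move=> pt; apply: eq_bigr => i _; rewrite -[LHS]/(orbit_deg (p i)).
  by apply: orbit_degE; rewrite orbit_repE ?tH //; exact: pt.
apply/asboolP/eqP => [[p [pt <-]]|t1]; first by rewrite degE.
have pt : represents (fun i => orbit_rep (t i)) t by move=> i; apply: orbit_repP.
by exists (fun i => orbit_rep (t i)); split=> //; rewrite degE.
Qed.

(** Changing representatives multiplies each factor, hence the tensor, by a
    scalar. *)
Lemma chi_lineE (t : I) : t \in D -> chi_line gamma t = <[b t]>%VS.
Proof.
move=> /pow_domP tD; apply/eqP; rewrite eqEsubv; apply/andP; split.
  apply: span_ofS => u [p [pt ->]].
  have /choice[c cE] i : exists c, chi gamma (p i).1 (p i).2 = c *: chi_basis gamma (t i).
    by have [c _ cE] := chi_basis_mem gamma (tD i) (pt i); exists c.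
  by rewrite (tprod_scale cE) memvZ ?memv_line.
rewrite -memvE; apply: mem_span_of; exists (fun i => orbit_rep (t i)); split=> // i.
exact: orbit_repP.
Qed.

Local Notation act := (pow_act (@orbit_translate _ H) (n := n.+1)).

Lemma regularE t : t \in D ->
  regular (zact T) (@left_act gT H n.+1) (@chi_line F gT w H gamma n.+1) t
  <-> is_regular b act t.
Proof.
move=> tD; split=> R g gt; first by apply: R; rewrite // chi_lineE ?memv_line.
by move=> v; rewrite chi_lineE // => /vlineP[c ->]; rewrite linearZ /= R.
Qed.

Lemma regular_orbitsE : regular_orbits gamma n.+1 = reg_orbits D b deg act.
Proof.
rewrite /regular_orbits GxHH_eE; apply/setP=> O.
by apply/imsetP/imsetP=> -[t]; rewrite inE => /andP[tN /asboolP tR] ->; exists t;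
  rewrite // inE tN; apply/asboolP/regularE => //; move: tN; rewrite inE => /andP[].
Qed.

Theorem lagrangian_braid_monomial (Hom := zHom (zunit w) T) :
  (exists rho : braid_group n.+1 -> 'End(subvs_of Hom),
     (forall (i : 'I_n.+1.-1) (f : subvs_of Hom),
        vsval (rho (braid_gen i) f) = (sigma L n.+1 i.+1 \o vsval f)%VF) /\
     (exists (X : finType) (line : X -> {vspace subvs_of Hom}),
        monomial_rep rho line)) /\
  \dim Hom = #|regular_orbits gamma n.+1|.
Proof.
have bL := chi_monomial_basis gamma; have bT := pow_monomial_basis bL n.
have act1 t : act 1%g t = t by apply/ffunP=> i; rewrite ffunE orbit_translate1.
have actM g h t : act (g * h)%g t = act g (act h t).
  by apply/ffunP=> i; rewrite !ffunE orbit_translateM.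
have [line [ms lines]] := regular_orbit_lines char0 bT act1 actM.
split; last first.
  by have := monomial_space_dim ms; rewrite card_sig -regular_orbitsE dimvf.
have post S (f : subvs_of Hom) : is_zmor S -> (S \o vsval f)%VF \in Hom.
  by move=> Sz; apply/zHomP/zmor_comp => //; apply/zHomP/subvsP.
pose P (i : 'I_n.+1.-1) : 'End(subvs_of Hom) :=
  linfun (fun f : subvs_of Hom => vsproj Hom (sigma L n.+1 i.+1 \o vsval f)%VF).
have PE i f : vsval (P i f) = (sigma L n.+1 i.+1 \o vsval f)%VF.
  rewrite /P linfun_linE ?vsprojK ?post //; first exact: sigma_zmor.
  by move=> a u v; rewrite linearP /= comp_lfunDr -comp_lfunZr linearP.
have P0 i : lker (P i) == 0%VS.
  apply/lker0P=> f f' /(congr1 vsval); rewrite !PE => E; apply: val_inj.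
  apply/lfunP=> z; move/lfunP/(_ z): E; rewrite !comp_lfunE.
  by move/lker0P: (sigma_inj L n i.+1); apply.
have Pc (i j : 'I_n.+1.-1) : (i.+1 < j)%N -> (P i \o P j = P j \o P i)%VF.
  move=> ij; apply/lfunP=> f; apply: val_inj; rewrite /= !comp_lfunE !PE !comp_lfunA.
  by rewrite sigma_comm //= !ltnS ij /=; case: (j).
have Py (i j : 'I_n.+1.-1) : j = i.+1 :> nat -> (P i \o (P j \o P i) = P j \o (P i \o P j))%VF.
  move=> ji; apply/lfunP=> f; apply: val_inj; rewrite /= !comp_lfunE !PE !comp_lfunA.
  have := @sigma_yang_baxter _ _ _ L n i.+1; rewrite /= -ji !comp_lfunA.
  by move=> -> //; case: (j).
have [rho [rhoR rhoE]] := braid_representation P0 Pc Py.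
exists rho; split; first by move=> i f; rewrite rhoE PE.
exists {O | O \in reg_orbits D b deg act}, line.
apply: (braid_permutes_lines ms rhoR) => i x; rewrite rhoE.
apply: (lines (sigma L n.+1 i.+1)); [exact: sigma_zmor|exact: sigma_inj|exact: PE|].
by move=> t tD; exact: (sigma_monomial bL).
Qed.

End Corollary.

Theorem corollary4p5 (R : realType) (gT : finGroupType)
    (omega : cocycle3 R[i] gT) (n : nat) (n_ge1 : (1 <= n)%N)
    (H : {group gT}) (gamma : trivialization omega H) :
  let L := Lalg gamma in
  let Hom := zHom (zunit omega) (tpow L n) in
  (exists rho : braid_group n -> 'End(subvs_of Hom),
     (forall (i : 'I_n.-1) (f : subvs_of Hom),
        vsval (rho (braid_gen i) f) = (sigma L n i.+1 \o vsval f)%VF) /\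
     (exists (X : finType) (line : X -> {vspace subvs_of Hom}),
        monomial_rep rho line)) /\
  \dim Hom = #|regular_orbits gamma n|.
Proof.
case: n n_ge1 => // n _; exact: (lagrangian_braid_monomial _ _ (Num.Theory.pchar_num R[i])).
Qed.
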